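(* Let $K$ be an algebraically closed field and $Q$ an acyclic quiver such that there is no nonzero projective-injective $KQ$-module. Then there is a one-to-one correspondence between $\mathbf{F}_1(Q)$ and $\mathbf{F}_2(Q)$, given by mutually inverse maps $\sigma^-:\mathbf{F}_1(Q)\to\mathbf{F}_2(Q)$ and $\sigma:\mathbf{F}_2(Q)\to\mathbf{F}_1(Q)$ such that $$\sigma^-(\mathcal{T}',\mathcal{F}')=(\tau^-\mathcal{T}',\ \tau^-\mathcal{F}'\oplus\mathcal{P}(Q))\quad\text{for all }(\mathcal{T}',\mathcal{F}')\in\mathbf{F}_1(Q),$$ $$\sigma(\mathcal{T}'',\mathcal{F}'')=(\mathcal{I}(Q)\oplus\tau\mathcal{T}'',\ \tau\mathcal{F}'')\quad\text{for all }(\mathcal{T}'',\mathcal{F}'')\in\mathbf{F}_2(Q).$$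
   Context: Modules are finite-dimensional left $KQ$-modules ($Q$ a finite quiver); $\tau$ is the Auslander–Reiten translation and $\tau^-$ its quasi-inverse. $\mathcal{P}(Q)$, $\mathcal{I}(Q)$ are the categories of finite-dimensional projective, injective $KQ$-modules. A torsion pair on $KQ\text{-mod}$ is a pair $(\mathcal{T},\mathcal{F})$ of full (isomorphism-closed) subcategories with $\mathrm{Hom}(X,Y)=0$ for $X\in\mathcal{T},Y\in\mathcal{F}$ and such that every module $X$ has an exact sequence $0\to X_{\mathcal{T}}\to X\to X_{\mathcal{F}}\to0$ with $X_{\mathcal T}\in\mathcal T,X_{\mathcal F}\in\mathcal F$. $\mathbf{F}_1(Q)$ is the set of torsion pairs $(\mathcal{T},\mathcal{F})$ on $KQ\text{-mod}$ with $\mathcal{I}(Q)\subseteq\mathcal{T}$, and $\mathbf{F}_2(Q)$ the set of those with $\mathcal{P}(Q)\subseteq\mathcal{F}$. For a subcategory $\mathcal{D}$, $\tau\mathcal{D}$ and $\tau^-\mathcal{D}$ denote the full subcategories of modules isomorphic to $\tau X$, resp. $\tau^-X$, with $X\in\mathcal{D}$; $\mathcal{A}\oplus\mathcal{B}$ is the full subcategory of modules isomorphic to $A\oplus B$ with $A\in\mathcal{A},B\in\mathcal{B}$. *)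

(* Defs.v *)
From HB Require Import structures.
From mathcomp Require Import all_boot all_order all_algebra.

Set Implicit Arguments.
Unset Strict Implicit.
Unset Printing Implicit Defensive.

Import GRing.Theory.
Local Open Scope ring_scope.

Record quiver := Quiver {
  vertex : finType;
  arrow : finType;
  arrow_src : arrow -> vertex;
  arrow_tgt : arrow -> vertex }.

(* [walk v s]: the arrows in [s], read in the order of traversal, form an
   oriented path that starts at [v] (the empty one if [s] is empty). *)
Fixpoint walk (Q : quiver) (v : vertex Q) (s : seq (arrow Q)) : bool :=
  if s is a :: s' then (arrow_src a == v) && walk (arrow_tgt a) s' else true.

Definition walk_end (Q : quiver) (v : vertex Q) (s : seq (arrow Q)) :=
  last v (map (@arrow_tgt Q) s).

Definition acyclic (Q : quiver) : Prop :=
  forall (v : vertex Q) (s : seq (arrow Q)),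
    walk v s -> walk_end v s = v -> s = [::].

Record acyclicQuiver := AcyclicQuiver {
  quiver_of :> quiver;
  acyclicP : acyclic quiver_of }.

Section Paths.
Variable Q : acyclicQuiver.
Implicit Types (v : vertex Q) (s : seq (arrow Q)).

Lemma walk_cat v s1 s2 :
  walk v (s1 ++ s2) = walk v s1 && walk (walk_end v s1) s2.
Proof.
elim: s1 v => //= a s1 IHs v.
by rewrite IHs andbA.
Qed.

Lemma walk_end_cat v s1 s2 :
  walk_end v (s1 ++ s2) = walk_end (walk_end v s1) s2.
Proof. by rewrite /walk_end map_cat last_cat. Qed.

Lemma walk_uniq v s : walk v s -> uniq (v :: map (@arrow_tgt Q) s).
Proof.
elim: s v => [|a s IHs] v //= /andP[/eqP av ws].
have -> /= : (v \notin arrow_tgt a :: map (@arrow_tgt Q) s); last exact: IHs.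
apply/negP => v_in.
have [n n_s] : exists n, walk_end v (take n.+1 (a :: s)) = v.
  have /(nthP v)[n n_lt <-] := v_in.
  exists n; rewrite /walk_end map_take.
  rewrite -[map _ (a :: s)]/(arrow_tgt a :: map (@arrow_tgt Q) s).
  rewrite (take_nth v) ?last_rcons //.
have: walk v (take n.+1 (a :: s)).
  have: walk v (a :: s) by rewrite /= av eqxx.
  by rewrite -{1}(cat_take_drop n.+1 (a :: s)) walk_cat => /andP[].
by move=> /(@acyclicP Q) /(_ n_s).
Qed.

Lemma walk_size v s : walk v s -> (size s < #|vertex Q|)%N.
Proof.
move=> /walk_uniq /card_uniqP; rewrite /= size_map => <-.
exact: max_card.
Qed.

Record qpath := QPath {
  path_val : vertex Q * seq (arrow Q);
  _ : walk path_val.1 path_val.2 }.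

HB.instance Definition _ := [isSub for path_val].
HB.instance Definition _ := [Countable of qpath by <:].

Definition path_code (p : qpath) : vertex Q * #|vertex Q|.-bseq (arrow Q) :=
  ((val p).1, insub_bseq _ (val p).2).
Definition path_decode (c : vertex Q * #|vertex Q|.-bseq (arrow Q)) :
  option qpath := insub (c.1, bseqval c.2).

Lemma path_codeK : pcancel path_code path_decode.
Proof.
case=> -[v s] /= ws; rewrite /path_code /path_decode /insub_bseq /= insubdK.
  by rewrite insubT.
exact: ltnW (walk_size ws).
Qed.

HB.instance Definition _ : isFinite qpath := PCanIsFinite path_codeK.

Definition path_src (p : qpath) : vertex Q := (val p).1.
Definition path_arrows (p : qpath) : seq (arrow Q) := (val p).2.
Definition path_tgt (p : qpath) : vertex Q :=
  walk_end (path_src p) (path_arrows p).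

(* The path "first [p], then [q]", when [p] ends where [q] starts. *)
Definition path_comp (q p : qpath) : option qpath :=
  if path_tgt p == path_src q
  then insub (path_src p, path_arrows p ++ path_arrows q) else None.

Lemma path_compP q p r :
  reflect [/\ path_tgt p = path_src q, path_src r = path_src p
            & path_arrows r = path_arrows p ++ path_arrows q]
          (path_comp q p == Some r).
Proof.
rewrite /path_comp; case: (path_tgt p =P path_src q) => [pq|pq]; last first.
  by apply: (iffP idP) => // -[e _ _]; case: (pq e).
case: insubP => [u _ def_u|].
  apply: (iffP eqP) => [[<-]|[_ rs ra]].
    by rewrite /path_src /path_arrows def_u.
  congr Some; apply: val_inj; rewrite def_u.
  by move: rs ra; rewrite /path_src /path_arrows; case: (val r) => x y /= -> ->.
rewrite /= walk_cat /path_arrows (valP p) /= => /negP[].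
by move: pq; rewrite /path_tgt /path_arrows => ->; apply: (valP q).
Qed.

Lemma path_comp_src q p r : path_comp q p = Some r -> path_src r = path_src p.
Proof. by move/eqP/path_compP => []. Qed.

Lemma path_comp_tgt q p r : path_comp q p = Some r -> path_tgt r = path_tgt q.
Proof.
move/eqP/path_compP => [pq rs ra].
by rewrite /path_tgt rs ra walk_end_cat -/(path_tgt p) pq.
Qed.

Lemma path_comp_def q p :
  path_tgt p = path_src q -> exists r, path_comp q p = Some r.
Proof.
move=> pq; have w : walk (path_src p) (path_arrows p ++ path_arrows q).
  by rewrite walk_cat (valP p) -/(path_tgt p) pq (valP q).
exists (@QPath (path_src p, path_arrows p ++ path_arrows q) w).
by apply/eqP/path_compP.
Qed.

Lemma path_comp_none q p : path_tgt p != path_src q -> path_comp q p = None.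
Proof. by rewrite /path_comp => /negPf ->. Qed.

Lemma path_compA (x y z : qpath) :
  obind (path_comp^~ z) (path_comp x y) = obind (path_comp x) (path_comp y z).
Proof.
case: (path_tgt y =P path_src x) => [yx|/eqP yx]; last first.
  rewrite (path_comp_none yx) /=.
  case yz: (path_comp y z) => [t|] //=.
  by rewrite path_comp_none // (path_comp_tgt yz).
case: (path_tgt z =P path_src y) => [zy|/eqP zy]; last first.
  rewrite (path_comp_none zy) /=.
  case xy: (path_comp x y) => [t|] //=.
  by rewrite path_comp_none // (path_comp_src xy).
have [a xya] := path_comp_def yx; have [b yzb] := path_comp_def zy.
rewrite xya yzb /=.
have [|c azc] := @path_comp_def a z; first by rewrite (path_comp_src xya).
rewrite azc; apply/esym/eqP/path_compP.
have /eqP/path_compP[_ cs ca] := azc.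
have /eqP/path_compP[_ as_ aa] := xya.
have /eqP/path_compP[_ bs ba] := yzb.
by rewrite (path_comp_tgt yzb) yx cs bs ca aa ba catA.
Qed.

Lemma trivial_walk v : walk v [::]. Proof. by []. Qed.
Definition path_id v : qpath := @QPath (v, [::]) (trivial_walk v).

Lemma path_comp_idr p : path_comp p (path_id (path_src p)) = Some p.
Proof. by apply/eqP/path_compP. Qed.

Lemma path_comp_idl p : path_comp (path_id (path_tgt p)) p = Some p.
Proof. by apply/eqP/path_compP; rewrite cats0. Qed.

Lemma path_eq p q :
  path_src p = path_src q -> path_arrows p = path_arrows q -> p = q.
Proof.
rewrite /path_src /path_arrows /= => pq_src pq_arr; apply: val_inj => /=.
by apply/eqP; rewrite -pair_eqE /pair_eq pq_src pq_arr !eqxx.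
Qed.

Lemma path_id_nil e : path_arrows e = [::] -> e = path_id (path_src e).
Proof. by move=> e0; apply: path_eq. Qed.

End Paths.

(* The path algebra: [Q] being acyclic, its oriented paths form a finite type,
   and an element is the family of its coordinates on the basis of paths. *)
Definition path_algebra (K : fieldType) (Q : acyclicQuiver) : predArgType :=
  {ffun qpath Q -> K}.

HB.instance Definition _ (K : fieldType) (Q : acyclicQuiver) :=
  Vector.copy (path_algebra K Q) {ffun qpath Q -> K^o}.

Section PathAlgebra.
Variables (K : fieldType) (Q : acyclicQuiver).
Implicit Types f g h : path_algebra K Q.

(* The product of two paths [q * p] is [q] after [p], or 0; so left modules
   are covariant representations of [Q]. *)
Definition path_mul f g : path_algebra K Q :=
  [ffun r => \sum_q \sum_(p | path_comp q p == Some r) f q * g p].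

Definition path_one : path_algebra K Q :=
  [ffun r : qpath Q => (path_arrows r == [::])%:R].


Lemma path_mulE f g r :
  path_mul f g r = \sum_q \sum_p
    (if path_comp q p == Some r then f q * g p else 0).
Proof. by rewrite ffunE; apply: eq_bigr => q _; rewrite big_mkcond. Qed.

Lemma sum_obind (o : option (qpath Q))
    (k : qpath Q -> option (qpath Q)) r (c : K) :
  \sum_x (if o == Some x then if k x == Some r then c else 0 else 0) =
  if obind k o == Some r then c else 0.
Proof.
case: o => [y|] /=; last by rewrite big1.
rewrite (bigD1 y) //= eqxx big1 ?addr0 // => x xy.
by case: eqP => // -[yx]; rewrite yx eqxx in xy.
Qed.

Lemma path_mulA : associative path_mul.
Proof.
move=> f g h; apply/ffunP => r; rewrite !path_mulE.
transitivity (\sum_x \sum_y \sum_z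
  (if obind (path_comp x) (path_comp y z) == Some r
   then f x * (g y * h z) else 0)).
  apply: eq_bigr => x _.
  transitivity (\sum_t \sum_y \sum_z
    (if path_comp y z == Some t then
       if path_comp x t == Some r then f x * (g y * h z) else 0 else 0)).
    apply: eq_bigr => t _; rewrite path_mulE.
    case: ifP => _; last by rewrite big1 // => y _; rewrite big1 // => z _; rewrite if_same.
    rewrite big_distrr; apply: eq_bigr => y _.
    rewrite big_distrr; apply: eq_bigr => z _ /=.
    by case: ifP => // _; rewrite mulr0.
  rewrite exchange_big; apply: eq_bigr => y _.
  rewrite exchange_big; apply: eq_bigr => z _.
  exact: sum_obind.
symmetry.
transitivity (\sum_z \sum_x \sum_y
  (if obind (path_comp x) (path_comp y z) == Some r
   then f x * (g y * h z) else 0)).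
  rewrite exchange_big; apply: eq_bigr => z _.
  transitivity (\sum_t \sum_x \sum_y
    (if path_comp x y == Some t then
       if path_comp t z == Some r then f x * (g y * h z) else 0 else 0)).
    apply: eq_bigr => t _; rewrite path_mulE.
    case: ifP => _; last by rewrite big1 // => y _; rewrite big1 // => x _; rewrite if_same.
    rewrite big_distrl; apply: eq_bigr => x _.
    rewrite big_distrl; apply: eq_bigr => y _ /=.
    by case: ifP => // _; rewrite ?mul0r // mulrA.
  rewrite exchange_big; apply: eq_bigr => x _.
  rewrite exchange_big; apply: eq_bigr => y _.
  by rewrite -path_compA -sum_obind.
rewrite exchange_big; apply: eq_bigr => x _.
by rewrite exchange_big.
Qed.

Lemma path_mul1 : left_id path_one path_mul.
Proof.
move=> f; apply/ffunP => r; rewrite path_mulE.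
rewrite (bigD1 (path_id (path_tgt r))) //= [X in _ + X]big1 ?addr0; last first.
  move=> q q_ne; rewrite big1 // => p _; case: eqP => // qpr.
  rewrite ffunE; case: eqP => [q0|]; last by rewrite mul0r.
  by case/eqP: q_ne; rewrite (path_comp_tgt qpr) {1}(path_id_nil q0) /path_tgt q0.
rewrite (bigD1 r) //= path_comp_idl eqxx ffunE eqxx mul1r big1 ?addr0 // => p p_ne.
case: path_compP => // -[pr rs]; rewrite cats0 => ra.
by case/eqP: p_ne; apply: path_eq.
Qed.

Lemma path_mulr1 : right_id path_one path_mul.
Proof.
move=> f; apply/ffunP => r; rewrite path_mulE exchange_big /=.
rewrite (bigD1 (path_id (path_src r))) //= [X in _ + X]big1 ?addr0; last first.
  move=> p p_ne; rewrite big1 // => q _; case: eqP => // qpr.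
  rewrite ffunE; case: eqP => [p0|]; last by rewrite mulr0.
  by case/eqP: p_ne; rewrite (path_comp_src qpr) {1}(path_id_nil p0).
rewrite (bigD1 r) //= path_comp_idr eqxx ffunE eqxx mulr1 big1 ?addr0 // => q q_ne.
case: path_compP => // -[pr rs /= ra].
by case/eqP: q_ne; apply: path_eq => //; rewrite -pr rs.
Qed.

Lemma path_mulDl : left_distributive path_mul +%R.
Proof.
move=> f g h; apply/ffunP => r; rewrite !ffunE -big_split.
apply: eq_bigr => q _; rewrite -big_split.
by apply: eq_bigr => p _; rewrite ffunE mulrDl.
Qed.

Lemma path_mulDr : right_distributive path_mul +%R.
Proof.
move=> f g h; apply/ffunP => r; rewrite !ffunE -big_split.
apply: eq_bigr => q _; rewrite -big_split.
by apply: eq_bigr => p _; rewrite ffunE mulrDr.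
Qed.

HB.instance Definition _ := GRing.Zmodule_isPzRing.Build (path_algebra K Q)
  path_mulA path_mul1 path_mulr1 path_mulDl path_mulDr.

Lemma path_scaleAl (c : K) f g : c *: (f * g) = (c *: f) * g.
Proof.
apply/ffunP => r; rewrite !ffunE scaler_sumr.
apply: eq_bigr => q _; rewrite scaler_sumr.
by apply: eq_bigr => p _; rewrite ffunE scalerAl.
Qed.

Lemma path_scaleAr (c : K) f g : c *: (f * g) = f * (c *: g).
Proof.
apply/ffunP => r; rewrite !ffunE scaler_sumr.
apply: eq_bigr => q _; rewrite scaler_sumr.
by apply: eq_bigr => p _; rewrite ffunE scalerAr.
Qed.

Definition path_elt (p : qpath Q) : path_algebra K Q :=
  [ffun q => (q == p)%:R].

Lemma path_elt_sum f : f = \sum_p f p *: path_elt p.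
Proof.
apply/ffunP => r; rewrite sum_ffunE (bigD1 r) //= !ffunE eqxx big1 ?addr0.
  by rewrite [RHS]mulr1.
by move=> p p_ne; rewrite !ffunE eq_sym (negPf p_ne) [LHS]mulr0.
Qed.

Lemma path_elt_mul q p :
  path_elt q * path_elt p = if path_comp q p is Some r then path_elt r else 0.
Proof.
apply/ffunP => r; rewrite [LHS]path_mulE (bigD1 q) //= [X in _ + X]big1 ?addr0.
  rewrite (bigD1 p) //= big1 ?addr0 => [|p' p'_ne].
    case: (path_comp q p) => [t|]; rewrite !ffunE // !eqxx mulr1.
    by rewrite (inj_eq Some_inj) eq_sym; case: eqP.
  by rewrite !ffunE (negPf p'_ne) mulr0 if_same.
move=> q' q'_ne; rewrite big1 // => p' _.
by rewrite !ffunE (negPf q'_ne) mul0r if_same.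
Qed.

End PathAlgebra.

(* Left and right modules are treated uniformly: a module on side [s] is a left
   module over the algebra with multiplication [smul s]. *)
Inductive side := Left | Right.

Definition opp_side (s : side) : side := if s is Left then Right else Left.

Definition smul (K : fieldType) (Q : acyclicQuiver) (s : side)
    (a b : path_algebra K Q) : path_algebra K Q :=
  if s is Left then a * b else b * a.

Record kqmod (K : fieldType) (Q : acyclicQuiver) (s : side) := KQMod {
  carrier :> vectType K;
  act : path_algebra K Q -> 'End(carrier);
  act_linear : linear act;
  act_one : act 1 = \1%VF;
  act_mul : forall a b, act (smul s a b) = (act a \o act b)%VF }.

Arguments act {K Q s} M : rename.

Section Modules.
Variables (K : fieldType) (Q : acyclicQuiver).
Local Notation A := (path_algebra K Q).
Local Notation kqmod := (kqmod K Q).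

HB.instance Definition _ s (M : kqmod s) :=
  GRing.isLinear.Build K A 'End(M) _ (act M) (@act_linear K Q s M).

Lemma smul_opp s (a b : A) : smul (opp_side s) a b = smul s b a.
Proof. by case: s. Qed.

Lemma smulA s (a b c : A) : smul s a (smul s b c) = smul s (smul s a b) c.
Proof. by case: s => /=; rewrite mulrA. Qed.

Lemma smul1 s (a : A) : smul s 1 a = a.
Proof. by case: s => /=; rewrite ?mul1r ?mulr1. Qed.

Lemma smul_linear s (a : A) : linear (smul s a).
Proof.
move=> c x y; case: s => /=; first by rewrite mulrDr path_scaleAr.
by rewrite mulrDl path_scaleAl.
Qed.

HB.instance Definition _ s a :=
  GRing.isLinear.Build K A A _ (smul s a) (@smul_linear s a).

Definition is_hom s (M N : kqmod s) (f : 'Hom(M, N)) : Prop :=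
  forall (a : A) (x : M), f (act M a x) = act N a (f x).

Definition injective_hom s (M N : kqmod s) (f : 'Hom(M, N)) : Prop :=
  is_hom f /\ injective f.

Definition surjective_hom s (M N : kqmod s) (f : 'Hom(M, N)) : Prop :=
  is_hom f /\ limg f = fullv.

Definition isomorphic s (M N : kqmod s) : Prop :=
  exists f : 'Hom(M, N), injective_hom f /\ surjective_hom f.

(* Projective and injective objects of the category of finite-dimensional
   modules. *)
Definition is_projective s (P : kqmod s) : Prop :=
  forall (M N : kqmod s) (g : 'Hom(M, N)) (f : 'Hom(P, N)),
    surjective_hom g -> is_hom f ->
    exists2 h : 'Hom(P, M), is_hom h & (g \o h)%VF = f.

Definition is_injective s (I : kqmod s) : Prop :=
  forall (M N : kqmod s) (g : 'Hom(M, N)) (f : 'Hom(M, I)),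
    injective_hom g -> is_hom f ->
    exists2 h : 'Hom(N, I), is_hom h & (h \o g)%VF = f.

Definition is_submodule s (M : kqmod s) (U : {vspace M}) : Prop :=
  forall (a : A) (x : M), x \in U -> act M a x \in U.

Definition superfluous s (M : kqmod s) (U : {vspace M}) : Prop :=
  forall V : {vspace M}, is_submodule V -> (U + V)%VS = fullv -> V = fullv.

(* [P1 -f-> P0 -p-> M -> 0] is exact, and [p] and [f : P1 -> lker p] are
   projective covers. *)
Definition minimal_projective_presentation s (P1 P0 M : kqmod s)
    (f : 'Hom(P1, P0)) (p : 'Hom(P0, M)) : Prop :=
  [/\ is_projective P1 /\ is_projective P0,
      is_hom f, surjective_hom p, limg f = lker p
    & superfluous (lker f) /\ superfluous (lker p)].

Section Regular.
Variable s : side.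

Definition reg_act (a : A) : 'End(A) := linfun (smul s a).

Lemma reg_act_linear : linear reg_act.
Proof.
move=> c a b; apply/lfunP => x.
rewrite add_lfunE scale_lfunE !lfunE /=; case: s => /=.
  by rewrite mulrDl path_scaleAl.
by rewrite mulrDr path_scaleAr.
Qed.

Lemma reg_act_one : reg_act 1 = \1%VF.
Proof. by apply/lfunP => x; rewrite !lfunE /= smul1. Qed.

Lemma reg_act_mul a b : reg_act (smul s a b) = (reg_act a \o reg_act b)%VF.
Proof. by apply/lfunP => x; rewrite comp_lfunE !lfunE /= smulA. Qed.

Definition regular_module : kqmod s :=
  KQMod reg_act_linear reg_act_one reg_act_mul.
End Regular.

Section Dual.
Variables (s : side) (M : kqmod s).
Local Notation D := 'Hom(M, K^o).

Definition precomp (a : A) (phi : D) : D := (phi \o act M a)%VF.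

Lemma precomp_linear a : linear (precomp a).
Proof. by move=> c x y; rewrite /precomp comp_lfunDl comp_lfunZl. Qed.

HB.instance Definition _ a :=
  GRing.isLinear.Build K D D _ (precomp a) (precomp_linear a).

Definition dual_act (a : A) : 'End(D) := linfun (precomp a).

Lemma dual_act_linear : linear dual_act.
Proof.
move=> c a b; apply/lfunP => x; rewrite add_lfunE scale_lfunE !lfunE /=.
by rewrite /precomp linearP comp_lfunDr comp_lfunZr.
Qed.

Lemma dual_act_one : dual_act 1 = \1%VF.
Proof. by apply/lfunP => x; rewrite !lfunE /= /precomp act_one comp_lfun1r. Qed.

Lemma dual_act_mul a b :
  dual_act (smul (opp_side s) a b) = (dual_act a \o dual_act b)%VF.
Proof.
apply/lfunP => x; rewrite comp_lfunE !lfunE /= /precomp smul_opp act_mul.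
by rewrite comp_lfunA.
Qed.

Definition dual : kqmod (opp_side s) :=
  KQMod dual_act_linear dual_act_one dual_act_mul.
End Dual.

Section HomSpace.
Variables (s : side) (M N : kqmod s).

Definition hom_defect (a : A) (f : 'Hom(M, N)) : 'Hom(M, N) :=
  (f \o act M a)%VF - (act N a \o f)%VF.

Lemma hom_defect_linear a : linear (hom_defect a).
Proof.
move=> c f g; apply/lfunP => x; rewrite /hom_defect.
rewrite !(add_lfunE, opp_lfunE, scale_lfunE, comp_lfunE) linearP /=.
by rewrite scalerBr opprD addrACA.
Qed.

HB.instance Definition _ a :=
  GRing.isLinear.Build K _ _ _ (hom_defect a) (hom_defect_linear a).

Definition hom_space : {vspace 'Hom(M, N)} :=
  (\bigcap_(p : qpath Q) lker (linfun (hom_defect (path_elt K p))))%VS.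

Lemma hom_spaceP (f : 'Hom(M, N)) : f \in hom_space <-> is_hom f.
Proof.
split=> [/subv_bigcapP f_in a x|f_hom]; last first.
  apply/subv_bigcapP => p _; rewrite -memvE memv_ker lfunE /=.
  apply/eqP/lfunP => x; rewrite zero_lfunE.
  by rewrite !(add_lfunE, opp_lfunE, comp_lfunE) f_hom subrr.
have f_elt p : f (act M (path_elt K p) x) = act N (path_elt K p) (f x).
  have := f_in p isT; rewrite -memvE memv_ker lfunE /= => /eqP/lfunP/(_ x).
  rewrite zero_lfunE !(add_lfunE, opp_lfunE, comp_lfunE).
  by move/eqP; rewrite subr_eq0 => /eqP.
rewrite (path_elt_sum a) !linear_sum !sum_lfunE linear_sum.
apply: eq_bigr => p _.
by rewrite !linearZ !scale_lfunE linearZ /= f_elt.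
Qed.

End HomSpace.

(* [Hom_KQ(M, KQ)], a module on the other side through the other-side action on
   [KQ]. *)
Section AlgebraDual.
Variables (s : side) (M : kqmod s).
Local Notation H := (hom_space M (regular_module s)).

Definition postcomp (a : A) (f : 'Hom(M, regular_module s)) :
  'Hom(M, regular_module s) := (act (regular_module (opp_side s)) a \o f)%VF.

Lemma postcomp_hom a f : f \in H -> postcomp a f \in H.
Proof.
move=> /hom_spaceP f_hom; apply/hom_spaceP => b x.
rewrite !comp_lfunE f_hom /= !lfunE /=.
by rewrite !smul_opp smulA.
Qed.

Definition adual_map (a : A) (f : subvs_of H) : subvs_of H :=
  vsproj H (postcomp a (vsval f)).

Lemma adual_mapE a f : vsval (adual_map a f) = postcomp a (vsval f).
Proof. by rewrite vsprojK // postcomp_hom // subvsP. Qed.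

Lemma vsval_linear c (f g : subvs_of H) :
  vsval (c *: f + g) = c *: vsval f + vsval g.
Proof. exact: linearP. Qed.

Lemma adual_map_linear a : linear (adual_map a).
Proof.
move=> c f g; apply: val_inj; rewrite /= !adual_mapE vsval_linear.
by rewrite /postcomp comp_lfunDr comp_lfunZr.
Qed.

HB.instance Definition _ a :=
  GRing.isLinear.Build K _ _ _ (adual_map a) (adual_map_linear a).

Definition adual_act (a : A) : 'End(subvs_of H) := linfun (adual_map a).

Lemma adual_act_linear : linear adual_act.
Proof.
move=> c a b; apply/lfunP => x; rewrite add_lfunE scale_lfunE !lfunE /=.
apply: val_inj; rewrite /= !adual_mapE.
by rewrite /postcomp linearP comp_lfunDl comp_lfunZl.
Qed.

Lemma adual_act_one : adual_act 1 = \1%VF.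
Proof.
apply/lfunP => x; rewrite !lfunE /=; apply: val_inj.
by rewrite /= adual_mapE /postcomp act_one comp_lfun1l.
Qed.

Lemma adual_act_mul a b :
  adual_act (smul (opp_side s) a b) = (adual_act a \o adual_act b)%VF.
Proof.
apply/lfunP => x; rewrite comp_lfunE !lfunE /=; apply: val_inj.
by rewrite /= !adual_mapE /postcomp act_mul comp_lfunA.
Qed.

Definition algebra_dual : kqmod (opp_side s) :=
  KQMod adual_act_linear adual_act_one adual_act_mul.
End AlgebraDual.

Section DirectSum.
Variables (s : side) (M N : kqmod s).

Definition dsum_map (a : A) (x : M * N) : M * N := (act M a x.1, act N a x.2).

Lemma dsum_map_linear a : linear (dsum_map a).
Proof. by move=> c x y; rewrite /dsum_map !linearP. Qed.

HB.instance Definition _ a :=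
  GRing.isLinear.Build K _ _ _ (dsum_map a) (dsum_map_linear a).

Definition dsum_act (a : A) : 'End((M * N)%type) := linfun (dsum_map a).

Lemma dsum_act_linear : linear dsum_act.
Proof.
move=> c a b; apply/lfunP => x; rewrite add_lfunE scale_lfunE !lfunE /=.
by rewrite /dsum_map !linearP /= !add_lfunE !scale_lfunE.
Qed.

Lemma dsum_act_one : dsum_act 1 = \1%VF.
Proof.
by apply/lfunP => -[x y]; rewrite !lfunE /= /dsum_map !act_one !id_lfunE.
Qed.

Lemma dsum_act_mul a b :
  dsum_act (smul s a b) = (dsum_act a \o dsum_act b)%VF.
Proof.
apply/lfunP => x; rewrite comp_lfunE !lfunE /= /dsum_map !act_mul.
by rewrite !comp_lfunE.
Qed.

Definition direct_sum : kqmod s :=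
  KQMod dsum_act_linear dsum_act_one dsum_act_mul.
End DirectSum.

(* [C] is (isomorphic to) the transpose of [M], the cokernel of
   [Hom_KQ(f, KQ) : Hom_KQ(P0, KQ) -> Hom_KQ(P1, KQ)] for a minimal projective
   presentation [P1 -f-> P0 -> M -> 0]. *)
Definition is_transpose s (M : kqmod s) (C : kqmod (opp_side s)) : Prop :=
  exists (P1 P0 : kqmod s) (f : 'Hom(P1, P0)) (p : 'Hom(P0, M))
         (c : 'Hom(algebra_dual P1, C)),
    [/\ minimal_projective_presentation f p,
        surjective_hom c
      & forall h : algebra_dual P1,
          c h = 0 <-> exists g : algebra_dual P0, vsval h = (vsval g \o f)%VF].

(* [N] is isomorphic to [tau M = D Tr M], resp. to [tau^- M = Tr D M]. *)
Definition is_tau (M N : kqmod Left) : Prop :=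
  exists C : kqmod Right, is_transpose M C /\ isomorphic N (dual C).

Definition is_tau_inv (M N : kqmod Left) : Prop :=
  is_transpose (dual M) N.

(* Full isomorphism-closed subcategories are given by their objects. *)
Definition subcategory := kqmod Left -> Prop.

Definition iso_closed (D : subcategory) : Prop :=
  forall M N : kqmod Left, isomorphic M N -> D M -> D N.

Definition Proj : subcategory := fun M => is_projective M.
Definition Inj : subcategory := fun M => is_injective M.

Definition tau_cat (D : subcategory) : subcategory :=
  fun N => exists2 M, D M & is_tau M N.

Definition tau_inv_cat (D : subcategory) : subcategory :=
  fun N => exists2 M, D M & is_tau_inv M N.

Definition dsum_cat (D E : subcategory) : subcategory :=
  fun N => exists M1 M2, [/\ D M1, E M2 & isomorphic N (direct_sum M1 M2)].

Definition subcat (D E : subcategory) : Prop := forall M, D M -> E M.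

Definition is_torsion_pair (TF : subcategory * subcategory) : Prop :=
  [/\ iso_closed TF.1, iso_closed TF.2,
      forall (X Y : kqmod Left) (f : 'Hom(X, Y)),
        TF.1 X -> TF.2 Y -> is_hom f -> f = 0
    & forall X : kqmod Left, exists (X1 X2 : kqmod Left)
        (i : 'Hom(X1, X)) (q : 'Hom(X, X2)),
        [/\ TF.1 X1, TF.2 X2, injective_hom i, surjective_hom q
          & limg i = lker q]].

Definition F1 :=
  {TF : subcategory * subcategory | is_torsion_pair TF /\ subcat Inj TF.1}.

Definition F2 :=
  {TF : subcategory * subcategory | is_torsion_pair TF /\ subcat Proj TF.2}.

End Modules.

Arguments Proj {K Q}.
Arguments Inj {K Q}.

(* Main.v *)
Require Import Defs.
From HB Require Import structures.
From mathcomp Require Import all_boot all_order all_algebra.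
From Stdlib Require Import Classical ClassicalEpsilon.
From Stdlib Require Import FunctionalExtensionality PropExtensionality.

(* Let D be the K-dual and Tr the transpose, so that tau = D Tr and
   tau^- = Tr D, and work on left and right modules at once. The heart is one
   construction: if (T, F) is a torsion pair on one side and F contains the
   projectives, then (Tr F, Tr T + proj) is such a pair on the other side.
   Since KQ is hereditary, Tr M is the cokernel of the dual of any projective
   resolution 0 -> P1 -> P0 -> M -> 0. Hence Hom(Tr M, proj) = 0; every
   map Tr M -> Tr N comes from a map N -> M and vanishes with it; and a module Z
   with Hom(Z, KQ) = 0 satisfies Tr Tr Z = Z, while every module is the
   direct sum of such a Z and a projective. An exact sequence 0 -> U -> Tr Z -> V -> 0 with
   U in T and V in F transposes to 0 -> Tr V -> Z -> Tr U -> 0.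
   Applying the construction twice gives back a pair containing (T, F), hence
   equal to it, a torsion pair being determined by either class. Finally, D
   exchanges F1(Q) with the right torsion pairs whose torsion-free class
   contains the projectives; sigma^- is D followed by the construction on right
   modules, and sigma is the construction on left modules followed by D. *)

Set Implicit Arguments.
Unset Strict Implicit.
Unset Printing Implicit Defensive.

Import GRing.Theory.
Local Open Scope ring_scope.

(** * Linear maps and module homomorphisms *)

Section Lfun.
Variable K : fieldType.

Lemma lfun_ex (U V : vectType K) (f : U -> V) :
  linear f -> exists F : 'Hom(U, V), F =1 f.
Proof.
move=> lf.
pose m := GRing.isLinear.Build K U V _ f lf.
pose fL : {linear U -> V} := HB.pack f m.
by exists (linfun fL) => x; rewrite lfunE.
Qed.

Lemma limg_fullP (U V : vectType K) (g : 'Hom(U, V)) :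
  limg g = fullv <-> forall y, exists x, g x = y.
Proof.
split=> [gs y|gs]; first by have /memv_imgP[x _ ->] : y \in limg g;
  [rewrite gs memvf|exists x].
apply/vspaceP => y; rewrite memvf; have [x <-] := gs y.
exact: memv_img (memvf x).
Qed.

Lemma limg_lkerP (U V W : vectType K) (f : 'Hom(U, V)) (g : 'Hom(V, W)) :
  limg f = lker g <-> forall y, g y = 0 <-> exists x, y = f x.
Proof.
split=> [e y|e]; last first.
  apply/vspaceP => y; rewrite memv_ker; apply/memv_imgP/eqP.
    by case=> x _ yx; apply/e; exists x.
  by move/e => [x ->]; exists x; rewrite ?memvf.
split=> [gy|[x ->]].
  have /memv_imgP[x _ ->] : y \in limg f by rewrite e memv_ker gy.
  by exists x.
by apply/eqP; rewrite -memv_ker -e memv_img ?memvf.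
Qed.

Lemma lfun_injP (U V : vectType K) (f : 'Hom(U, V)) :
  injective f <-> forall x, f x = 0 -> x = 0.
Proof.
split=> [fi x fx|f0 x y fxy]; first by apply: fi; rewrite fx linear0.
by apply/eqP; rewrite -subr_eq0; apply/eqP/f0; rewrite linearB /= fxy subrr.
Qed.

Lemma comp_lfun_suml (U V W : vectType K) (I : finType)
    (F : I -> 'Hom(V, W)) (g : 'Hom(U, V)) :
  ((\sum_i F i) \o g = \sum_i (F i \o g))%VF.
Proof.
apply/lfunP => x; rewrite comp_lfunE !sum_lfunE.
by apply: eq_bigr => i _; rewrite comp_lfunE.
Qed.

Lemma comp_lfun_sumr (U V W : vectType K) (I : finType)
    (F : I -> 'Hom(U, V)) (g : 'Hom(V, W)) :
  (g \o (\sum_i F i) = \sum_i (g \o F i))%VF.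
Proof.
apply/lfunP => x; rewrite comp_lfunE !sum_lfunE linear_sum.
by apply: eq_bigr => i _; rewrite comp_lfunE.
Qed.

End Lfun.

Section Homs.
Variables (K : fieldType) (Q : acyclicQuiver).
Local Notation A := (path_algebra K Q).
Local Notation kqmod := (kqmod K Q).

Section Side.
Variable s : side.
Implicit Types L M N X : kqmod s.

Lemma hom_ex M N (f : M -> N) :
  linear f -> (forall a x, f (act M a x) = act N a (f x)) ->
  exists2 F : 'Hom(M, N), is_hom F & F =1 f.
Proof.
move=> /lfun_ex[F Ff] fh; exists F => // a x.
by rewrite !Ff.
Qed.

Lemma is_hom_comp L M N (g : 'Hom(M, N)) (f : 'Hom(L, M)) :
  is_hom g -> is_hom f -> is_hom (g \o f)%VF.
Proof. by move=> gh fh a x; rewrite !comp_lfunE fh gh. Qed.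

Lemma is_hom_id M : is_hom (\1%VF : 'Hom(M, M)).
Proof. by move=> a x; rewrite !id_lfunE. Qed.

Lemma is_hom0 M N : is_hom (0 : 'Hom(M, N)).
Proof. by move=> a x; rewrite !zero_lfunE linear0. Qed.

Lemma surjective_homP M N (g : 'Hom(M, N)) :
  surjective_hom g <-> is_hom g /\ forall y, exists x, g x = y.
Proof. by split=> -[gh /limg_fullP]. Qed.

Lemma surjective_hom_comp L M N (g : 'Hom(M, N)) (f : 'Hom(L, M)) :
  surjective_hom g -> surjective_hom f -> surjective_hom (g \o f)%VF.
Proof.
move=> /surjective_homP[gh gs] /surjective_homP[fh fs]; apply/surjective_homP.
split=> [|z]; first exact: is_hom_comp.
have [y <-] := gs z; have [x <-] := fs y.
by exists x; rewrite comp_lfunE.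
Qed.

Lemma injective_hom_comp L M N (g : 'Hom(M, N)) (f : 'Hom(L, M)) :
  injective_hom g -> injective_hom f -> injective_hom (g \o f)%VF.
Proof.
move=> [gh gi] [fh fi]; split=> [|x y]; first exact: is_hom_comp.
by rewrite !comp_lfunE => /gi/fi.
Qed.

(** Any linear section of [g] serves: the kernel condition makes [f \o g^-1] independent of the
    chosen preimages, hence compatible with the action. *)
Lemma factor_surj M N X (g : 'Hom(M, N)) (f : 'Hom(M, X)) :
  surjective_hom g -> is_hom f -> (forall x, g x = 0 -> f x = 0) ->
  exists2 h : 'Hom(N, X), is_hom h & forall x, h (g x) = f x.
Proof.
move=> [gh gs] fh gf.
have fgV x : f ((g^-1)%VF (g x)) = f x.
  apply/eqP; rewrite -subr_eq0 -linearB /=; apply/eqP/gf.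
  by rewrite linearB /= limg_lfunVK ?subrr // gs memvf.
exists (f \o g^-1)%VF => [a y|x]; last by rewrite comp_lfunE fgV.
rewrite !comp_lfunE.
have [x <-] := (limg_fullP g).1 gs y.
by rewrite -gh !fgV fh.
Qed.

Lemma factor_inj L M X (i : 'Hom(L, M)) (f : 'Hom(X, M)) :
  injective_hom i -> is_hom f -> (forall x, exists y, f x = i y) ->
  exists2 h : 'Hom(X, L), is_hom h & forall x, i (h x) = f x.
Proof.
move=> [ih ii] fh fi.
have iV : cancel i (i^-1)%VF by apply/lker0_lfunK/lker0P.
have ihK x : i ((i^-1)%VF (f x)) = f x by have [y ->] := fi x; rewrite iV.
exists (i^-1 \o f)%VF => [a x|x]; last by rewrite comp_lfunE.
by rewrite !comp_lfunE; apply: ii; rewrite ih !ihK fh.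
Qed.

Lemma isoP M N : isomorphic M N <->
  exists (f : 'Hom(M, N)) (g : 'Hom(N, M)),
    [/\ is_hom f, is_hom g, cancel f g & cancel g f].
Proof.
split=> [[f [[fh fi] fs]]|[f [g [fh gh fK gK]]]].
  have f0 x : f x = 0 -> (\1%VF : 'Hom(M, M)) x = 0.
    by rewrite id_lfunE; apply: (lfun_injP f).1.
  have [g gh gf] := factor_surj fs (@is_hom_id M) f0.
  exists f, g; split=> // [x|y]; first by rewrite gf id_lfunE.
  have [x <-] := (limg_fullP f).1 fs.2 y.
  by rewrite gf id_lfunE.
exists f; split; first by split=> //; apply: can_inj fK.
by apply/surjective_homP; split=> // y; exists (g y).
Qed.

Lemma iso_refl M : isomorphic M M.
Proof.
by apply/isoP; exists \1%VF, \1%VF; split=> [||x|x]; rewrite ?id_lfunE //;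
  apply: is_hom_id.
Qed.

Lemma iso_sym M N : isomorphic M N -> isomorphic N M.
Proof. by move=> /isoP[f [g [? ? ? ?]]]; apply/isoP; exists g, f. Qed.

Lemma iso_trans L M N : isomorphic L M -> isomorphic M N -> isomorphic L N.
Proof.
move=> [f [fi fs]] [g [gi gs]]; exists (g \o f)%VF.
by split; [apply: injective_hom_comp|apply: surjective_hom_comp].
Qed.

(** * Submodules, quotients, kernels, cokernels and images *)

Section Transfer.
Variables (M : kqmod s) (V : vectType K) (j : 'Hom(V, M)) (r : 'Hom(M, V)).
Hypothesis jK : cancel j r.
Hypothesis stab : forall a b x,
  r (act M a (j (r (act M b (j x))))) = r (act M a (act M b (j x))).

(** The compression of the action to a linear retract. [stab] makes it multiplicative; it holds when
    the image of [j] is a submodule and also when the kernel of [r] is one, so submodules and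
    quotients are obtained alike. *)
Definition transfer_act (a : A) : 'End(V) := (r \o act M a \o j)%VF.

Lemma transfer_linear : linear transfer_act.
Proof.
move=> c a b; apply/lfunP => x.
rewrite !(add_lfunE, scale_lfunE, comp_lfunE) linearP.
by rewrite !(add_lfunE, scale_lfunE) linearP.
Qed.

Lemma transfer_one : transfer_act 1 = \1%VF.
Proof. by apply/lfunP => x; rewrite !comp_lfunE act_one !id_lfunE jK. Qed.

Lemma transfer_mul a b :
  transfer_act (smul s a b) = (transfer_act a \o transfer_act b)%VF.
Proof. by apply/lfunP => x; rewrite !comp_lfunE act_mul !comp_lfunE stab. Qed.

Definition transfer_module : kqmod s :=
  KQMod transfer_linear transfer_one transfer_mul.
End Transfer.

Lemma submodule_ex M (U : {vspace M}) : is_submodule U ->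
  exists (L : kqmod s) (i : 'Hom(L, M)), injective_hom i /\ limg i = U.
Proof.
move=> Us.
pose j : 'Hom(subvs_of U, M) := linfun vsval.
pose r : 'Hom(M, subvs_of U) := linfun (vsproj U).
have jK : cancel j r by move=> x; rewrite !lfunE /= vsvalK.
have rK x : x \in U -> j (r x) = x by move=> xU; rewrite !lfunE /= vsprojK.
have jU x : j x \in U by rewrite lfunE subvsP.
have st a b x :
    r (act M a (j (r (act M b (j x))))) = r (act M a (act M b (j x))).
  by rewrite rK // Us.
exists (transfer_module jK st), j; split; last first.
  apply/vspaceP => x; apply/memv_imgP/idP => [[y _ ->]//|xU].
  by exists (r x); rewrite ?memvf ?rK.
split=> [a x|]; last exact: can_inj jK.
by rewrite !comp_lfunE rK // Us.
Qed.

(* The quotient of [M] by the kernel of a merely linear map [h]. *)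
Lemma quotient_ex M (W : vectType K) (h : 'Hom(M, W)) :
  (forall a x, h x = 0 -> h (act M a x) = 0) ->
  exists (N : kqmod s) (q : 'Hom(M, N)),
    surjective_hom q /\ forall x, q x = 0 <-> h x = 0.
Proof.
move=> hs.
pose r : 'Hom(M, subvs_of (limg h)) := (linfun (vsproj (limg h)) \o h)%VF.
pose j : 'Hom(subvs_of (limg h), M) := (h^-1 \o linfun vsval)%VF.
have hj x : h (j x) = vsval x.
  by rewrite comp_lfunE limg_lfunVK lfunE // subvsP.
have rE x : vsval (r x) = h x.
  by rewrite comp_lfunE lfunE /= vsprojK // memv_img ?memvf.
have jK : cancel j r by move=> x; apply: val_inj; rewrite /= rE hj.
have r0 x : r x = 0 <-> h x = 0.
  split=> [rx|hx]; first by rewrite -rE rx linear0.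
  by rewrite comp_lfunE hx linear0.
have st' a x : r (act M a (j (r x))) = r (act M a x).
  apply/eqP; rewrite -subr_eq0 -!linearB /=; apply/eqP/r0/hs.
  by apply/r0; rewrite linearB /= jK subrr.
have st a b x :
    r (act M a (j (r (act M b (j x))))) = r (act M a (act M b (j x))).
  exact: st'.
exists (transfer_module jK st), r; split=> //; apply/surjective_homP.
split=> [a x|y]; last by exists (j y).
  have -> : act (transfer_module jK st) a (r x) = r (act M a (j (r x))).
    by rewrite /= /transfer_act comp_lfunE (comp_lfunE r).
  by rewrite st'.
Qed.

Lemma cokernel_ex L M (f : 'Hom(L, M)) : is_hom f ->
  exists (N : kqmod s) (q : 'Hom(M, N)),
    surjective_hom q /\ forall y, q y = 0 <-> exists x, y = f x.
Proof.
(* A linear projection whose kernel is the image of [f]. *)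
move=> fh; pose h : 'End(M) := (\1 - projv (limg f))%VF.
have h0 y : h y = 0 <-> exists x, y = f x.
  rewrite /h add_lfunE opp_lfunE id_lfunE; split=> [/eqP|[x ->]].
    rewrite subr_eq0 => /eqP ->.
    by have /memv_imgP[x _ ->] := memv_proj (limg f) y; exists x.
  by rewrite projv_id ?subrr // memv_img ?memvf.
have [|N [q [qs q0]]] := @quotient_ex M M h.
  by move=> a x /h0[y ->]; apply/h0; exists (act L a y); rewrite fh.
by exists N, q; split=> // y; apply: iff_trans (q0 y) (h0 y).
Qed.

Lemma image_ex L M (f : 'Hom(L, M)) : is_hom f ->
  exists (N : kqmod s) (q : 'Hom(L, N)) (i : 'Hom(N, M)),
    [/\ surjective_hom q, injective_hom i & forall x, i (q x) = f x].
Proof.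
move=> fh.
have [|N [i [ih ie]]] := @submodule_ex M (limg f).
  by move=> a y /memv_imgP[x _ ->]; rewrite -fh memv_img ?memvf.
have [|q qh qE] := factor_inj ih fh.
  move=> x; have : f x \in limg i by rewrite ie memv_img ?memvf.
  by case/memv_imgP => y _ ->; exists y.
exists N, q, i; split=> //; apply/surjective_homP; split=> // y.
have : i y \in limg f by rewrite -ie memv_img ?memvf.
by case/memv_imgP => x _ /esym e; exists x; apply: ih.2; rewrite qE.
Qed.

Lemma kernel_ex M N (g : 'Hom(M, N)) : is_hom g ->
  exists (L : kqmod s) (i : 'Hom(L, M)),
    injective_hom i /\ forall x, g x = 0 <-> exists y, x = i y.
Proof.
move=> gh; have [|L [i [ih ie]]] := @submodule_ex M (lker g).
  by move=> a x; rewrite !memv_ker gh => /eqP ->; rewrite linear0.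
by exists L, i; split=> //; apply/limg_lkerP.
Qed.

Lemma iso_dsum M N X (i : 'Hom(M, X)) (j : 'Hom(N, X)) (p : 'Hom(X, M))
    (q : 'Hom(X, N)) : is_hom i -> is_hom j -> is_hom p -> is_hom q ->
  cancel i p -> cancel j q -> (forall x, i (p x) + j (q x) = x) ->
  isomorphic X (direct_sum M N).
Proof.
move=> ih jh ph qh ipK jqK dec.
(* The mixed composites vanish: decomposing [j y] gives [i (p (j y)) = 0], and [p] retracts [i]. *)
have pj y : p (j y) = 0.
  have /eqP := dec (j y); rewrite jqK -subr_eq0 addrK => /eqP e.
  by rewrite -[LHS]ipK e linear0.
have qi x : q (i x) = 0.
  have /eqP := dec (i x); rewrite ipK addrC -subr_eq0 addrK => /eqP e.
  by rewrite -[LHS]jqK e linear0.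
have [|a x|F Fh FE] := @hom_ex X (direct_sum M N) (fun x => (p x, q x) : M * N).
- by move=> c x y; rewrite !linearP.
- by rewrite ph qh /= lfunE.
have [|a x|G Gh GE] := @hom_ex (direct_sum M N) X (fun z : M * N => i z.1 + j z.2).
- by move=> c x y; rewrite !linearP /= scalerDr addrACA.
- by rewrite /= lfunE /= ih jh linearD.
apply/isoP; exists F, G; split=> // [x|[x y]]; first by rewrite GE FE /= dec.
by rewrite FE GE /= !linearD /= ipK jqK pj qi addr0 add0r.
Qed.

Lemma dsum_maps M N : exists (i : 'Hom(M, direct_sum M N))
    (j : 'Hom(N, direct_sum M N)) (p : 'Hom(direct_sum M N, M))
    (q : 'Hom(direct_sum M N, N)),
  [/\ is_hom i, is_hom j, is_hom p & is_hom q] /\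
  [/\ i =1 (fun x => (x, 0) : M * N), j =1 (fun y => (0, y) : M * N),
      p =1 (fun z : M * N => z.1) & q =1 (fun z : M * N => z.2)].
Proof.
have [||i ih iE] := @hom_ex M (direct_sum M N) (fun x => (x, 0) : M * N).
- by move=> c x y; apply/eqP; rewrite -pair_eqE /= scaler0 addr0 !eqxx.
- by move=> a x; rewrite /= lfunE /= /dsum_map /= linear0.
have [||j jh jE] := @hom_ex N (direct_sum M N) (fun x => (0, x) : M * N).
- by move=> c x y; apply/eqP; rewrite -pair_eqE /= scaler0 addr0 !eqxx.
- by move=> a x; rewrite /= lfunE /= /dsum_map /= linear0.
have [||p ph pE] := @hom_ex (direct_sum M N) M (fun z : M * N => z.1).
- by [].
- by move=> a x; rewrite /= lfunE.
have [||q qh qE] := @hom_ex (direct_sum M N) N (fun z : M * N => z.2).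
- by [].
- by move=> a x; rewrite /= lfunE.
by exists i, j, p, q.
Qed.

Definition zero_hom M N := forall f : 'Hom(M, N), is_hom f -> f = 0.

Lemma zero_hom_sub M N X (i : 'Hom(N, X)) :
  injective_hom i -> zero_hom M X -> zero_hom M N.
Proof.
move=> [ih ii] z f fh; apply/lfunP => x; rewrite zero_lfunE; apply: ii.
by rewrite -comp_lfunE (z _ (is_hom_comp ih fh)) zero_lfunE linear0.
Qed.

Lemma zero_hom_quo M N X (q : 'Hom(X, M)) :
  surjective_hom q -> zero_hom X N -> zero_hom M N.
Proof.
move=> /surjective_homP[qh qs] z f fh; apply/lfunP => y; rewrite zero_lfunE.
have [x <-] := qs y.
by rewrite -comp_lfunE (z _ (is_hom_comp fh qh)) zero_lfunE.
Qed.

Lemma zero_hom_iso M N M' N' :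
  isomorphic M M' -> isomorphic N N' -> zero_hom M N -> zero_hom M' N'.
Proof.
move=> [f [_ fs]] /iso_sym[g [gi _]] z.
exact: zero_hom_sub gi (zero_hom_quo fs z).
Qed.

End Side.
End Homs.

(** * Hereditarity *)

Definition is_left (s : side) : bool := if s is Left then true else false.

Section Representations.
Variables (K : fieldType) (Q : acyclicQuiver).
Local Notation A := (path_algebra K Q).
Local Notation kqmod := (kqmod K Q).
Variable s : side.

(* The product for which the action of a module on side [s] is
   multiplicative. *)
Definition scomp (V : vectType K) (f g : 'End(V)) : 'End(V) :=
  if is_left s then (f \o g)%VF else (g \o f)%VF.

Lemma act_mulS (M : kqmod s) (a b : A) :
  act M (a * b) = scomp (act M a) (act M b).
Proof.
by rewrite /scomp; case: s M => M /=; rewrite -act_mul.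
Qed.

(** * Modules defined by operators at the vertices and arrows *)

Section FromArrows.
Variables (V : vectType K) (e : vertex Q -> 'End(V)) (x : arrow Q -> 'End(V)).
Local Notation "f ⊙ g" := (@scomp V f g) (at level 40, left associativity).

Hypothesis e_orth : forall v w, e v ⊙ e w = if v == w then e v else 0.
Hypothesis e_sum : \sum_v e v = \1%VF.
Hypothesis x_src : forall a, x a ⊙ e (arrow_src a) = x a.

Lemma scompA (f g h : 'End(V)) : f ⊙ (g ⊙ h) = f ⊙ g ⊙ h.
Proof. by rewrite /scomp; case: (is_left s); rewrite comp_lfunA. Qed.

Lemma scomp0f (f : 'End(V)) : 0 ⊙ f = 0.
Proof. by rewrite /scomp; case: (is_left s); rewrite (comp_lfun0l, comp_lfun0r). Qed.

Lemma scompf0 (f : 'End(V)) : f ⊙ 0 = 0.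
Proof. by rewrite /scomp; case: (is_left s); rewrite (comp_lfun0l, comp_lfun0r). Qed.

Lemma scompZ (c d : K) (f g : 'End(V)) :
  (c *: f) ⊙ (d *: g) = (c * d) *: (f ⊙ g).
Proof.
rewrite /scomp; case: (is_left s); rewrite -comp_lfunZl -comp_lfunZr scalerA //.
by rewrite mulrC.
Qed.

Lemma scomp_suml (I : finType) (F : I -> 'End(V)) g :
  (\sum_i F i) ⊙ g = \sum_i (F i ⊙ g).
Proof.
by rewrite /scomp; case: (is_left s); rewrite (comp_lfun_suml, comp_lfun_sumr).
Qed.

Lemma scomp_sumr (I : finType) (F : I -> 'End(V)) g :
  g ⊙ (\sum_i F i) = \sum_i (g ⊙ F i).
Proof.
by rewrite /scomp; case: (is_left s); rewrite (comp_lfun_suml, comp_lfun_sumr).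
Qed.

(** The empty walk acts by the idempotent [e v], so the operator of a walk always carries the
    idempotent of its end point; this is why [rep_arr] asks that [x a] be compatible with its
    target. *)
Fixpoint walk_op (v : vertex Q) (w : seq (arrow Q)) : 'End(V) :=
  if w is a :: w' then walk_op (arrow_tgt a) w' ⊙ x a else e v.

Lemma walk_op_src v w : walk v w -> walk_op v w ⊙ e v = walk_op v w.
Proof.
case: w => [|a w] /=; first by rewrite e_orth eqxx.
by case/andP => /eqP <- _; rewrite -scompA x_src.
Qed.

Lemma walk_op_tgt v w : e (walk_end v w) ⊙ walk_op v w = walk_op v w.
Proof.
elim: w v => [|a w IHw] v /=; first by rewrite e_orth eqxx.
by rewrite scompA IHw.
Qed.

Lemma walk_op_cat v w1 w2 : walk v (w1 ++ w2) ->
  walk_op v (w1 ++ w2) = walk_op (walk_end v w1) w2 ⊙ walk_op v w1.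
Proof.
elim: w1 v => [|a w1 IHw] v /= => [/walk_op_src //|/andP[_ /IHw ->]].
by rewrite scompA.
Qed.

Definition path_op (p : qpath Q) := walk_op (path_src p) (path_arrows p).

Lemma path_op_mul q p :
  path_op q ⊙ path_op p = if path_comp q p is Some r then path_op r else 0.
Proof.
case: (path_tgt p =P path_src q) => [pq|/eqP pq]; last first.
  (* When the end points do not match, the idempotents at the source of [q] and at the target of [p]
     can be inserted in the middle, and they are orthogonal. *)
  rewrite path_comp_none // /path_op.
  rewrite -(@walk_op_src (path_src q) (path_arrows q)).
    rewrite -scompA -(@walk_op_tgt (path_src p)) -/(path_tgt p).
    by rewrite (scompA (e _)) e_orth eq_sym (negPf pq) scomp0f scompf0.
  exact: valP q.
have [r qpr] := path_comp_def pq; rewrite qpr.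
have /eqP/path_compP[_ rs ra] := qpr.
rewrite /path_op rs ra walk_op_cat -/(path_tgt p) ?pq //.
by rewrite -rs -ra; apply: valP r.
Qed.

Definition rep_act (a : A) : 'End(V) := \sum_p a p *: path_op p.

Lemma rep_act_linear : linear rep_act.
Proof.
move=> c a b; rewrite /rep_act scaler_sumr -big_split; apply: eq_bigr => p _.
by rewrite !ffunE scalerDl scalerA.
Qed.

Lemma rep_act_one : rep_act 1 = \1%VF.
Proof.
rewrite -e_sum /rep_act (bigID (fun p => path_arrows p == [::])) /=.
rewrite [X in _ + X]big1 ?addr0 => [|p /negPf p0]; last by rewrite ffunE p0 scale0r.
rewrite (reindex_onto (@path_id Q) (@path_src Q)) /= => [|p /eqP/path_id_nil //].
apply: eq_big => [v|v _]; first by rewrite !eqxx.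
by rewrite ffunE /= scale1r.
Qed.

Lemma rep_act_mulS a b : rep_act (a * b) = rep_act a ⊙ rep_act b.
Proof.
rewrite /rep_act scomp_suml.
under [RHS]eq_bigr => q _.
  rewrite scomp_sumr; under eq_bigr => p _ do rewrite scompZ path_op_mul.
  over.
(* The pairs of paths are grouped by their composite [r]; the inner double sum is then a coefficient
   of the product in the path algebra. *)
transitivity (\sum_r \sum_q \sum_p
    (if path_comp q p == Some r then a q * b p else 0) *: path_op r).
  apply: eq_bigr => r _; under eq_bigr => q _ do rewrite -scaler_suml.
  by rewrite -scaler_suml -path_mulE.
rewrite exchange_big; apply: eq_bigr => q _.
rewrite exchange_big; apply: eq_bigr => p _ /=.
case: (path_comp q p) => [t|]; last first.
  by rewrite scaler0 big1 // => r _; rewrite scale0r.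
rewrite (bigD1 t) //= eqxx big1 ?addr0 // => r rt.
by case: eqP => [[/esym/eqP]|_]; rewrite ?scale0r // (negPf rt).
Qed.

Lemma rep_act_mul a b :
  rep_act (smul s a b) = (rep_act a \o rep_act b)%VF.
Proof.
move: (rep_act_mulS a b) (rep_act_mulS b a).
by rewrite /scomp /smul; case: (s).
Qed.

Definition rep_module : kqmod s :=
  KQMod rep_act_linear rep_act_one rep_act_mul.

Lemma rep_act_elt p : act rep_module (path_elt K p) = path_op p.
Proof.
rewrite /= /rep_act (bigD1 p) //= !ffunE eqxx scale1r big1 ?addr0 // => q qp.
by rewrite !ffunE (negPf qp) scale0r.
Qed.

End FromArrows.

Lemma arrow_walk (a : arrow Q) : walk (arrow_src a) [:: a].
Proof. by rewrite /= eqxx. Qed.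

Definition path_arrow (a : arrow Q) : qpath Q :=
  @QPath Q (arrow_src a, [:: a]) (arrow_walk a).

Definition vtx (v : vertex Q) : A := path_elt K (path_id v).
Definition arr (a : arrow Q) : A := path_elt K (path_arrow a).

Lemma vtx_orth v w : vtx v * vtx w = if v == w then vtx v else 0.
Proof.
rewrite path_elt_mul; case: (v =P w) => [->|/eqP vw].
  by rewrite (path_comp_idl (path_id w)).
by rewrite path_comp_none // eq_sym.
Qed.

Lemma vtx_sum : \sum_v vtx v = 1.
Proof.
apply/ffunP => p; rewrite sum_ffunE ffunE.
have [p0|p0] := eqVneq; last first.
  rewrite big1 // => v _; rewrite ffunE; case: eqP => // pv.
  by rewrite pv in p0.
rewrite (bigD1 (path_src p)) //= ffunE -path_id_nil // eqxx big1 ?addr0 // => v.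
by rewrite ffunE; case: (p =P _) => [->|//]; rewrite eqxx.
Qed.

Lemma vtx_tgt a : vtx (arrow_tgt a) * arr a = arr a.
Proof. by rewrite path_elt_mul (path_comp_idl (path_arrow a)). Qed.

Lemma vtx_src a : arr a * vtx (arrow_src a) = arr a.
Proof. by rewrite path_elt_mul (path_comp_idr (path_arrow a)). Qed.

Lemma rep_vtx (V : vectType K) (e : vertex Q -> 'End(V)) x eo es xs v :
  act (@rep_module V e x eo es xs) (vtx v) = e v.
Proof. by rewrite rep_act_elt. Qed.

Lemma rep_arr (V : vectType K) (e : vertex Q -> 'End(V)) x eo es xs a :
  scomp (e (arrow_tgt a)) (x a) = x a ->
  act (@rep_module V e x eo es xs) (arr a) = x a.
Proof. by move=> xt; rewrite rep_act_elt /path_op /= xt. Qed.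

(** Vertices and arrows generate the path algebra: a nontrivial path is a shorter path after its
    first arrow, and linearity does the rest. *)
Lemma hom_gen (M N : kqmod s) (f : 'Hom(M, N)) :
  (forall v x, f (act M (vtx v) x) = act N (vtx v) (f x)) ->
  (forall a x, f (act M (arr a) x) = act N (arr a) (f x)) -> is_hom f.
Proof.
move=> fv fa.
suff fw w p : path_arrows p = w ->
    forall x, f (act M (path_elt K p) x) = act N (path_elt K p) (f x).
  move=> a x; rewrite (path_elt_sum a) !linear_sum !sum_lfunE linear_sum.
  by apply: eq_bigr => p _; rewrite !linearZ !scale_lfunE linearZ /= (fw _ p erefl).
elim: w p => [|a w IHw] p pw x; first by rewrite (path_id_nil pw) fv.
have := valP p; rewrite -/(path_arrows p) -/(path_src p) pw => /= /andP[/eqP ap ww].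
pose q := @QPath Q (arrow_tgt a, w) ww.
have -> : path_elt K p = path_elt K q * arr a.
  rewrite path_elt_mul; have /path_compP/eqP -> // :
    [/\ path_tgt (path_arrow a) = path_src q,
        path_src p = path_src (path_arrow a)
      & path_arrows p = path_arrows (path_arrow a) ++ path_arrows q].
  by split.
rewrite !act_mulS /scomp; have {}IHw := IHw q erefl.
case: (is_left s); rewrite !comp_lfunE.
  by rewrite IHw fa.
by rewrite fa IHw.
Qed.

(* Averaging over the vertices makes a linear map compatible with the
   decomposition of the modules along the vertices. *)
Definition vtx_avg (M N : kqmod s) (h : 'Hom(M, N)) : 'Hom(M, N) :=
  \sum_v (act N (vtx v) \o h \o act M (vtx v))%VF.

(** On right modules the two factors act in the opposite order, which is harmless because the vertex
    idempotents commute. *)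
Lemma vtx_act (M : kqmod s) v w x :
  act M (vtx v) (act M (vtx w) x) = if v == w then act M (vtx v) x else 0.
Proof.
have e0 u y : act M (if u then y else 0) x = if u then act M y x else 0.
  by case: u; rewrite // linear0 zero_lfunE.
have e3 : vtx w * vtx v = vtx v * vtx w.
  by rewrite !vtx_orth eq_sym; case: eqP => [->|].
rewrite -comp_lfunE -e0 -vtx_orth -act_mul.
by congr (fun_of_lfun (act M _) x); case: s.
Qed.

Lemma vtx_act_sum (M : kqmod s) x : \sum_v act M (vtx v) x = x.
Proof. by rewrite -sum_lfunE -linear_sum vtx_sum /= act_one id_lfunE. Qed.

Lemma vtx_avgC (M N : kqmod s) (h : 'Hom(M, N)) v x :
  vtx_avg h (act M (vtx v) x) = act N (vtx v) (vtx_avg h x).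
Proof.
rewrite !sum_lfunE linear_sum /=; apply: eq_bigr => w _.
rewrite !comp_lfunE; have [->|vw] := eqVneq v w; first by rewrite !vtx_act !eqxx.
by rewrite !vtx_act eq_sym (negPf vw) !linear0.
Qed.

Lemma vtx_avg_id (M N : kqmod s) (h : 'Hom(M, N)) :
  (forall v x, h (act M (vtx v) x) = act N (vtx v) (h x)) -> vtx_avg h = h.
Proof.
move=> hv; apply/lfunP => x; rewrite sum_lfunE -[RHS]vtx_act_sum.
by apply: eq_bigr => v _; rewrite !comp_lfunE hv vtx_act eqxx.
Qed.

Lemma vtx_avg_compl (M N X : kqmod s) (g : 'Hom(N, X)) (h : 'Hom(M, N)) :
  is_hom g -> (g \o vtx_avg h)%VF = vtx_avg (g \o h)%VF.
Proof.
move=> gh; rewrite comp_lfun_sumr; apply: eq_bigr => v _.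
by apply/lfunP => x; rewrite !comp_lfunE gh.
Qed.

Lemma vtx_avg_compr (L M N : kqmod s) (i : 'Hom(L, M)) (h : 'Hom(M, N)) :
  is_hom i -> (vtx_avg h \o i)%VF = vtx_avg (h \o i)%VF.
Proof.
move=> ih; rewrite comp_lfun_suml; apply: eq_bigr => v _.
by apply/lfunP => x; rewrite !comp_lfunE ih.
Qed.

(** * Extensions with prescribed off-diagonal terms at the arrows *)

Section Twist.
Variables (X M : kqmod s) (phi : arrow Q -> 'Hom(M, X)).

(** An upper triangular operator with off-diagonal entry [ph]. Entry 0 at the vertices and [phi a]
    at the arrows give an extension of [M] by [X]: the arrows satisfy no relations, so [phi] only
    has to respect sources and targets. *)
Definition twist_map (a : A) (ph : 'Hom(M, X)) (z : X * M) : X * M :=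
  (act X a z.1 + ph z.2, act M a z.2).

Lemma twist_map_linear a ph : linear (twist_map a ph).
Proof.
by move=> c y z; rewrite /twist_map !linearP /= addrACA -scalerDr.
Qed.

HB.instance Definition _ a ph :=
  GRing.isLinear.Build K _ _ _ (twist_map a ph) (twist_map_linear a ph).

Definition twist_op a ph : 'End((X * M)%type) := linfun (twist_map a ph).

Lemma twist_opE a ph z : twist_op a ph z = (act X a z.1 + ph z.2, act M a z.2).
Proof. by rewrite lfunE. Qed.

Local Notation e v := (twist_op (vtx v) 0).
Local Notation x a := (twist_op (arr a) (phi a)).

Lemma twist_orth v w : scomp (e v) (e w) = if v == w then e v else 0.
Proof.
have ev v' z : e v' z = (act X (vtx v') z.1, act M (vtx v') z.2).
  by rewrite twist_opE zero_lfunE addr0.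
have evw z v1 w1 : e v1 (e w1 z) = if v1 == w1 then e v1 z else 0.
  by rewrite !ev /= !vtx_act; case: eqP.
transitivity (e v \o e w)%VF.
  rewrite /scomp; case: (is_left s) => //; apply/lfunP => z; rewrite !comp_lfunE !evw.
  by rewrite eq_sym; case: eqP => [->|].
apply/lfunP => z; rewrite comp_lfunE evw.
by case: eqP; rewrite ?zero_lfunE.
Qed.

Lemma twist_sum : \sum_v e v = \1%VF.
Proof.
apply/lfunP => z; rewrite sum_lfunE id_lfunE.
have -> : \sum_v e v z =
    (\sum_v act X (vtx v) z.1, \sum_v act M (vtx v) z.2).
  elim/big_rec3: _ => // v a b c _ ->.
  by rewrite twist_opE zero_lfunE addr0.
by rewrite !vtx_act_sum; case: z.
Qed.

Hypothesis x_tgt : forall a, scomp (e (arrow_tgt a)) (x a) = x a.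
Hypothesis x_src : forall a, scomp (x a) (e (arrow_src a)) = x a.

Definition twist_module : kqmod s := rep_module twist_orth twist_sum x_src.

Lemma twist_vtx v z : act twist_module (vtx v) z =
  (act X (vtx v) z.1, act M (vtx v) z.2).
Proof.
transitivity (e v z); last by rewrite twist_opE zero_lfunE addr0.
by congr (fun_of_lfun _ z); apply: rep_vtx.
Qed.

Lemma twist_arr a z : act twist_module (arr a) z =
  (act X (arr a) z.1 + phi a z.2, act M (arr a) z.2).
Proof.
rewrite -twist_opE; congr (fun_of_lfun _ z).
exact/rep_arr/x_tgt.
Qed.

End Twist.

End Representations.

(** * Submodules of projective modules *)

Section Hereditary.
Variables (K : fieldType) (Q : acyclicQuiver).
Local Notation kqmod := (kqmod K Q).
Local Notation vtx := (@vtx K Q).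
Local Notation arr := (@arr K Q).

Lemma arr_tgt s (N : kqmod s) a x :
  (if is_left s then act N (vtx (arrow_tgt a)) (act N (arr a) x)
   else act N (arr a) (act N (vtx (arrow_tgt a)) x)) = act N (arr a) x.
Proof.
rewrite -[in RHS]vtx_tgt act_mulS /scomp.
by case: (is_left s); rewrite comp_lfunE.
Qed.

Lemma arr_src s (N : kqmod s) a x :
  (if is_left s then act N (arr a) (act N (vtx (arrow_src a)) x)
   else act N (vtx (arrow_src a)) (act N (arr a) x)) = act N (arr a) x.
Proof.
rewrite -[in RHS]vtx_src act_mulS /scomp.
by case: (is_left s); rewrite comp_lfunE.
Qed.

Lemma twist_module_tgt s (X M : kqmod s) (phi : arrow Q -> 'Hom(M, X)) a :
  (forall x, (if is_left s then act X (vtx (arrow_tgt a)) (phi a x)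
              else phi a (act M (vtx (arrow_tgt a)) x)) = phi a x) ->
  scomp s (twist_op (vtx (arrow_tgt a)) (0 : 'Hom(M, X)))
    (twist_op (arr a) (phi a)) = twist_op (arr a) (phi a).
Proof.
move: (@arr_tgt s X a) (@arr_tgt s M a) => eX eM h; apply/lfunP => z.
move: (eX z.1) (eM z.2) (h z.2); rewrite /scomp.
by case: (is_left s) => e1 e2 e3;
  rewrite comp_lfunE !twist_opE zero_lfunE addr0 ?linearD /= e1 e2 e3.
Qed.

Lemma twist_module_src s (X M : kqmod s) (phi : arrow Q -> 'Hom(M, X)) a :
  (forall x, (if is_left s then phi a (act M (vtx (arrow_src a)) x)
              else act X (vtx (arrow_src a)) (phi a x)) = phi a x) ->
  scomp s (twist_op (arr a) (phi a))
    (twist_op (vtx (arrow_src a)) (0 : 'Hom(M, X))) = twist_op (arr a) (phi a).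
Proof.
move: (@arr_src s X a) (@arr_src s M a) => eX eM h; apply/lfunP => z.
move: (eX z.1) (eM z.2) (h z.2); rewrite /scomp.
by case: (is_left s) => e1 e2 e3;
  rewrite comp_lfunE !twist_opE zero_lfunE addr0 ?linearD /= e1 e2 e3.
Qed.

(* A lift of [f : L -> N] along [g : X -> N] that is only linear and compatible
   with the vertices has a defect [phi a : L -> ker g] at each arrow; the defect
   extends to [M], where it defines an extension of [M] by [X]. A splitting of
   that extension corrects the lift. *)
Lemma injective_hom_projective s (L M : kqmod s) (i : 'Hom(L, M)) :
  injective_hom i -> is_projective M -> is_projective L.
Proof.
move=> [ih ii] projM X N g f [gh gs] fh.
pose h0 := vtx_avg (g^-1 \o f)%VF.
have h0v v x : h0 (act L (vtx v) x) = act X (vtx v) (h0 x) by apply: vtx_avgC.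
have gh0 x : g (h0 x) = f x.
  rewrite -comp_lfunE vtx_avg_compl // (_ : (g \o (g^-1 \o f))%VF = f).
    by rewrite vtx_avg_id.
  by apply/lfunP => y; rewrite !comp_lfunE limg_lfunVK // gs memvf.
pose rho := vtx_avg (i^-1)%VF.
have rhov v x : rho (act M (vtx v) x) = act L (vtx v) (rho x) by apply: vtx_avgC.
have rhoi x : rho (i x) = x.
  rewrite -comp_lfunE vtx_avg_compr // (_ : (i^-1 \o i)%VF = \1%VF).
    by rewrite vtx_avg_id ?id_lfunE // => v y; rewrite !id_lfunE.
  by apply/lfunP => y; rewrite comp_lfunE lker0_lfunK ?id_lfunE //; apply/lker0P.
pose phi a : 'Hom(M, X) :=
  (((act X (arr a) \o h0) - (h0 \o act L (arr a))) \o rho)%VF.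
have phiE a x : phi a x =
    act X (arr a) (h0 (rho x)) - h0 (act L (arr a) (rho x)).
  by rewrite comp_lfunE add_lfunE opp_lfunE !comp_lfunE.
have gphi a x : g (phi a x) = 0.
  by rewrite phiE linearB /= gh !gh0 fh subrr.
have xt : forall a, scomp s (twist_op (vtx (arrow_tgt a)) (0 : 'Hom(M, X)))
    (twist_op (arr a) (phi a)) = twist_op (arr a) (phi a).
  move=> a; apply: twist_module_tgt => x; have := @arr_tgt s X a; have := @arr_tgt s L a.
  case: (is_left s) => eL eX; rewrite !phiE.
    by rewrite linearB /= eX -h0v eL.
  by rewrite rhov h0v eX eL.
have xs : forall a, scomp s (twist_op (arr a) (phi a))
    (twist_op (vtx (arrow_src a)) (0 : 'Hom(M, X))) = twist_op (arr a) (phi a).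
  move=> a; apply: twist_module_src => x.
  have := @arr_src s X a; have := @arr_src s L a.
  case: (is_left s) => eL eX; rewrite !phiE.
    by rewrite rhov h0v eX eL.
  by rewrite linearB /= eX -h0v eL.
pose E := twist_module xs.
(* The inclusion of [M] is lifted along [E -> N + M] rather than a splitting of [E -> M] being
   taken: this forces the first component of the lift into the kernel of [g], so adding it to [h0]
   does not change the composite with [g]. *)
have [|G GE] := @lfun_ex K E (direct_sum N M) (fun z : X * M => (g z.1, z.2) : N * M).
  by move=> c y z; rewrite !linearP.
have Gh : is_hom G.
  apply: hom_gen => [v|a] z; rewrite !GE [act (direct_sum N M) _ _]lfunE.
    by rewrite [act E _ _]twist_vtx /= gh.
  by rewrite [act E _ _](twist_arr xt) /= linearD /= gh gphi addr0.
have Gs : surjective_hom G.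
  apply/surjective_homP; split=> // -[y m]; have [x <-] := (limg_fullP g).1 gs y.
  by exists (x, m); rewrite GE.
have [_ [j [_ [_ [[_ jh _ _] [_ jE _ _]]]]]] := dsum_maps N M.
have [H Hh GH] := projM _ _ _ _ Gs jh.
have Heq m : g (H m).1 = 0 /\ (H m).2 = m.
  have := jE m; rewrite -GH comp_lfunE GE => -[? ?] //.
have [|psi psiE] := @lfun_ex K M X (fun m => (H m).1).
  by move=> c x y; rewrite linearP.
have Harr a m : (H (act M (arr a) m)).1 = act X (arr a) (H m).1 + phi a m.
  by rewrite Hh [act E _ _](twist_arr xt) /= (Heq m).2.
have Hvtx v m : (H (act M (vtx v) m)).1 = act X (vtx v) (H m).1.
  by rewrite Hh [act E _ _]twist_vtx.
have hE l : (h0 + (psi \o i))%VF l = h0 l + (H (i l)).1.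
  by rewrite add_lfunE comp_lfunE psiE.
exists (h0 + (psi \o i))%VF; last first.
  by apply/lfunP => l; rewrite comp_lfunE hE linearD /= gh0 (Heq _).1 addr0.
apply: hom_gen => [v|a] l; rewrite !hE ih ?Harr ?Hvtx !linearD /=.
  by rewrite h0v.
(* On the image of [i] the term [phi a] is exactly the defect of [h0], since [rho] retracts [i]; the
   two cancel. *)
by rewrite phiE rhoi addrCA addrC [h0 _ + _]addrC subrK.
Qed.

End Hereditary.

(** * Projective modules and dual bases *)

Section Projectives.
Variables (K : fieldType) (Q : acyclicQuiver).
Local Notation A := (path_algebra K Q).
Local Notation kqmod := (kqmod K Q).
Local Notation reg := (@regular_module K Q).

Lemma reg_actE s (a : A) (b : reg s) : act (reg s) a b = smul s a b.
Proof. by rewrite /= lfunE. Qed.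

Lemma smulr1 s (a : A) : smul s a 1 = a.
Proof. by case: s; rewrite /= (mulr1, mul1r). Qed.

Section FreeModule.
Variables (s : side) (n : nat).
Local Notation F := {ffun 'I_n -> A}.

Definition free_map (a : A) (u : F) : F := [ffun i => smul s a (u i)].

Lemma free_map_linear a : linear (free_map a).
Proof. by move=> c u v; apply/ffunP => i; rewrite !ffunE linearP. Qed.

HB.instance Definition _ a :=
  GRing.isLinear.Build K F F _ (free_map a) (free_map_linear a).

Definition free_act (a : A) : 'End(F) := linfun (free_map a).

Lemma free_act_linear : linear free_act.
Proof.
move=> c a b; apply/lfunP => u; rewrite add_lfunE scale_lfunE !lfunE /=.
apply/ffunP => i; rewrite !ffunE -!reg_actE linearP.
by rewrite add_lfunE scale_lfunE.
Qed.

Lemma free_act_one : free_act 1 = \1%VF.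
Proof. by apply/lfunP => u; apply/ffunP => i; rewrite !lfunE /= ffunE smul1. Qed.

Lemma free_act_mul a b :
  free_act (smul s a b) = (free_act a \o free_act b)%VF.
Proof.
apply/lfunP => u; apply/ffunP => i.
by rewrite comp_lfunE !lfunE /= !ffunE smulA.
Qed.

Definition free_module : kqmod s :=
  KQMod free_act_linear free_act_one free_act_mul.

Lemma free_actE a (u : free_module) i : act free_module a u i = smul s a (u i).
Proof. by rewrite /= lfunE ffunE. Qed.

Lemma free_module_ex (M : kqmod s) (b : 'I_n -> M) :
  exists2 p : 'Hom(free_module, M), is_hom p
    & p =1 (fun u : F => \sum_i act M (u i) (b i)).
Proof.
apply: hom_ex => [c u v|a u].
  rewrite scaler_sumr -big_split; apply: eq_bigr => i _.
  by rewrite !ffunE linearP add_lfunE scale_lfunE.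
rewrite linear_sum; apply: eq_bigr => i _.
by rewrite free_actE act_mul comp_lfunE.
Qed.
End FreeModule.

Lemma free_cover s (M : kqmod s) : exists n (b : 'I_n -> M)
    (p : 'Hom(free_module s n, M)), surjective_hom p /\
  p =1 (fun u : {ffun 'I_n -> A} => \sum_i act M (u i) (b i)).
Proof.
pose n := \dim {:M}; pose b (i : 'I_n) := (vbasis {:M})`_i : M.
have [p ph pE] := @free_module_ex s n M b.
exists n, b, p; split=> //; apply/surjective_homP; split=> // y.
exists ([ffun i => coord (vbasis {:M}) i y *: (1 : A)] : {ffun 'I_n -> A}).
rewrite pE [RHS](coord_vbasis (memvf y)); apply: eq_bigr => i _.
by rewrite ffunE linearZ /= act_one scale_lfunE id_lfunE.
Qed.

Section Side.
Variable s : side.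
Implicit Types P M N : kqmod s.

Definition ad_fun P (phi : algebra_dual P) : 'Hom(P, reg s) := vsval phi.

Lemma ad_funP P (phi : algebra_dual P) : is_hom (ad_fun phi).
Proof. exact/hom_spaceP/subvsP. Qed.

Lemma ad_hom P (phi : algebra_dual P) a x :
  ad_fun phi (act P a x) = smul s a (ad_fun phi x).
Proof. by rewrite ad_funP reg_actE. Qed.

Lemma ad_act P (phi : algebra_dual P) a x :
  ad_fun (act (algebra_dual P) a phi) x = smul (opp_side s) a (ad_fun phi x).
Proof. by rewrite /ad_fun /= lfunE /= adual_mapE comp_lfunE reg_actE. Qed.

Lemma ad_ext P (phi psi : algebra_dual P) :
  ad_fun phi =1 ad_fun psi -> phi = psi.
Proof. by move=> e; apply/val_inj/lfunP. Qed.

Lemma ad_ex P (h : 'Hom(P, reg s)) : is_hom h ->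
  exists phi : algebra_dual P, ad_fun phi = h.
Proof.
by move=> hh; exists (vsproj _ h); apply/vsprojK/hom_spaceP.
Qed.

Lemma ad_linear P c (phi psi : algebra_dual P) x :
  ad_fun (c *: phi + psi) x = c *: ad_fun phi x + ad_fun psi x.
Proof.
by rewrite /ad_fun [vsval _]linearP add_lfunE scale_lfunE.
Qed.

Lemma ad_funZ P c (phi : algebra_dual P) x :
  ad_fun (c *: phi) x = c *: ad_fun phi x.
Proof. by rewrite /ad_fun [vsval _]linearZ scale_lfunE. Qed.

Lemma ad_funD P (phi psi : algebra_dual P) x :
  ad_fun (phi + psi) x = ad_fun phi x + ad_fun psi x.
Proof. by rewrite /ad_fun [vsval _]linearD add_lfunE. Qed.

Lemma ad_funN P (phi : algebra_dual P) x : ad_fun (- phi) x = - ad_fun phi x.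
Proof. by rewrite /ad_fun [vsval _]linearN opp_lfunE. Qed.

Lemma ad_sum P (I : finType) (F : I -> algebra_dual P) x :
  ad_fun (\sum_i F i) x = \sum_i ad_fun (F i) x.
Proof. by rewrite /ad_fun [vsval _]linear_sum sum_lfunE. Qed.

Lemma ad_fun0 P x : ad_fun (0 : algebra_dual P) x = 0.
Proof. by rewrite /ad_fun [vsval _]linear0 zero_lfunE. Qed.

(** The finite family of the dual basis lemma. Its existence is equivalent to projectivity, and it
    turns statements about linear forms on projectives into finite sums. *)
Definition dual_basis P n (x : 'I_n -> P) (phi : 'I_n -> algebra_dual P) :=
  forall y, \sum_i act P (ad_fun (phi i) y) (x i) = y.

Lemma dual_basis_projective P n (x : 'I_n -> P) phi :
  dual_basis x phi -> is_projective P.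
Proof.
move=> db M N g f /surjective_homP[gh gs] fh.
have [||h hh hE] := @hom_ex K Q s P M
    (fun y => \sum_i act M (ad_fun (phi i) y) ((g^-1)%VF (f (x i)))).
- move=> c y z; rewrite scaler_sumr -big_split; apply: eq_bigr => i _.
  by rewrite linearP linearP add_lfunE scale_lfunE.
- move=> a y; rewrite linear_sum; apply: eq_bigr => i _.
  by rewrite ad_hom act_mul comp_lfunE.
exists h => //; apply/lfunP => y; rewrite comp_lfunE hE linear_sum /=.
rewrite -{2}(db y) linear_sum; apply: eq_bigr => i _ /=.
rewrite gh fh limg_lfunVK //; have [z <-] := gs (f (x i)).
by rewrite memv_img ?memvf.
Qed.

(** A free cover of [P] splits; the coordinates of the splitting are the forms, the images of the
    free generators are the vectors. *)
Lemma projective_dual_basis P : is_projective P ->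
  exists n (x : 'I_n -> P) phi, dual_basis x phi.
Proof.
move=> projP; have [n [b [p [ps pE]]]] := free_cover P.
have [h hh ph1] := projP _ _ _ _ ps (@is_hom_id _ _ s P).
have hi i : exists phi : algebra_dual P, forall y, ad_fun phi y = h y i.
  have [||k kh kE] := @hom_ex K Q s P (reg s) (fun y => h y i).
  - by move=> c y z; rewrite linearP !ffunE.
  - by move=> a y; rewrite hh free_actE reg_actE.
  by have [phi phiE] := ad_ex kh; exists phi => y; rewrite phiE kE.
have [phi phiE] := fin_all_exists hi.
exists n, b, phi => y; rewrite -[RHS](id_lfunE y) -ph1 comp_lfunE pE.
by apply: eq_bigr => i _; rewrite phiE.
Qed.

End Side.

Lemma ad_coord_ex s n (i : 'I_n) :
  exists phi : algebra_dual (free_module s n), forall u, ad_fun phi u = u i.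
Proof.
have [||k kh kE] := @hom_ex K Q s (free_module s n) (reg s)
  (fun u : {ffun 'I_n -> A} => u i).
- by move=> c y z; rewrite !ffunE.
- by move=> a y; rewrite free_actE reg_actE.
by have [phi phiE] := ad_ex kh; exists phi => y; rewrite phiE kE.
Qed.

Lemma free_projective s n : is_projective (free_module s n).
Proof.
have [phi phiE] := fin_all_exists (@ad_coord_ex s n).
pose delta i : free_module s n :=
  [ffun j => if i == j then 1 else 0] : {ffun 'I_n -> A}.
apply: (dual_basis_projective (x := delta) (phi := phi)) => u.
apply/ffunP => j; rewrite sum_ffunE (bigD1 j) //= -/(free_module s n).
rewrite free_actE phiE ffunE eqxx smulr1 big1 ?addr0 // => i ij.
by rewrite free_actE phiE ffunE (negPf ij) linear0.
Qed.

Lemma enough_projectives s (M : kqmod s) :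
  exists (P : kqmod s) (p : 'Hom(P, M)), is_projective P /\ surjective_hom p.
Proof.
have [n [b [p [ps _]]]] := free_cover M.
by exists (free_module s n), p; split; first exact: free_projective.
Qed.

End Projectives.

(** * Transposes *)

Section Transpose.
Variables (K : fieldType) (Q : acyclicQuiver).
Local Notation A := (path_algebra K Q).
Local Notation kqmod := (kqmod K Q).
Local Notation reg := (@regular_module K Q).

(** * The functor Hom(-, KQ) and projective resolutions *)

Section AlgebraDuality.
Variable s : side.
Implicit Types P R M N : kqmod s.

Lemma projective_separated P (x : P) : is_projective P ->
  (forall phi : algebra_dual P, ad_fun phi x = 0) -> x = 0.
Proof.
move=> /projective_dual_basis[n [b [phi db]]] x0; rewrite -(db x).
by apply: big1 => i _; rewrite x0 linear0 zero_lfunE.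
Qed.

(** Vectors and forms exchange roles: the forms [phi] generate the dual, and evaluation at [x i]
    gives the coefficients. With [ev_ex] this is a dual basis of [algebra_dual P]. *)
Lemma dual_basis_ad P n (x : 'I_n -> P) phi : dual_basis x phi ->
  forall psi : algebra_dual P,
    \sum_i act (algebra_dual P) (ad_fun psi (x i)) (phi i) = psi.
Proof.
move=> db psi; apply: ad_ext => y; rewrite ad_sum -{2}(db y) linear_sum.
by apply: eq_bigr => i _; rewrite ad_act smul_opp /= ad_hom.
Qed.

Lemma ev_ex P (x : P) : exists Phi : algebra_dual (algebra_dual P),
  forall phi : algebra_dual P, ad_fun Phi phi = ad_fun phi x.
Proof.
have [||k kh kE] := @hom_ex K Q (opp_side s) (algebra_dual P)
    (reg (opp_side s)) (fun phi => ad_fun phi x).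
- by move=> c phi psi; exact: (ad_linear c phi psi x).
- by move=> a phi; rewrite ad_act reg_actE.
by have [Phi PhiE] := ad_ex kh; exists Phi => phi; rewrite PhiE kE.
Qed.

Lemma algebra_dual_projective P :
  is_projective P -> is_projective (algebra_dual P).
Proof.
move=> /projective_dual_basis[n [x [phi db]]].
have [Phi PhiE] := fin_all_exists (fun i => ev_ex (x i)).
apply: (dual_basis_projective (x := phi) (phi := Phi)) => psi.
rewrite -[RHS](dual_basis_ad db); apply: eq_bigr => i _.
by rewrite PhiE.
Qed.

(** Evaluation is onto the double dual: expanding a form in a dual basis shows that [Phi] is
    determined by its values on the [phi i], which are the coefficients of the required vector. *)
Lemma ad_reflexive P (Phi : algebra_dual (algebra_dual P)) : is_projective P ->
  exists x : P, forall phi : algebra_dual P, ad_fun Phi phi = ad_fun phi x.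
Proof.
move=> /projective_dual_basis[n [x [phi db]]].
exists (\sum_i act P (ad_fun Phi (phi i)) (x i)) => psi.
rewrite -[in LHS](dual_basis_ad db psi) !linear_sum.
apply: eq_bigr => i _; rewrite [RHS]ad_hom -smul_opp.
exact: (ad_hom Phi).
Qed.

Lemma ad_map_ex P R (f : 'Hom(P, R)) : is_hom f ->
  exists2 F : 'Hom(algebra_dual R, algebra_dual P), is_hom F
    & forall psi x, ad_fun (F psi) x = ad_fun psi (f x).
Proof.
move=> fh.
have F0 psi : {phi : algebra_dual P | forall x, ad_fun phi x = ad_fun psi (f x)}.
  pose h := (ad_fun psi \o f)%VF.
  exists (vsproj _ h : algebra_dual P) => x; rewrite /ad_fun vsprojK ?comp_lfunE //.
  exact/hom_spaceP/is_hom_comp/fh/ad_funP.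
have [||F Fh FE] := @hom_ex K Q (opp_side s) (algebra_dual R) (algebra_dual P)
    (fun psi => sval (F0 psi)).
- move=> c phi psi; apply: ad_ext => x; rewrite ad_linear !(svalP (F0 _)).
  exact: ad_linear.
- by move=> a psi; apply: ad_ext => x; rewrite ad_act !(svalP (F0 _)) ad_act.
by exists F => // psi x; rewrite FE (svalP (F0 _)).
Qed.

(** The images of the dual basis forms of [R] under [g] are the coordinates of [f]; only [R] has to
    be projective. *)
Lemma ad_full P R (g : 'Hom(algebra_dual R, algebra_dual P)) :
  is_projective R -> is_hom g ->
  exists2 f : 'Hom(P, R), is_hom f
    & forall psi x, ad_fun (g psi) x = ad_fun psi (f x).
Proof.
move=> /projective_dual_basis[n [r [rho db]]] gh.
have [||f fh fE] := @hom_ex K Q s P R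
    (fun x => \sum_i act R (ad_fun (g (rho i)) x) (r i)).
- move=> c y z; rewrite scaler_sumr -big_split; apply: eq_bigr => i _.
  by rewrite linearP linearP add_lfunE scale_lfunE.
- move=> a y; rewrite linear_sum; apply: eq_bigr => i _.
  by rewrite ad_hom act_mul comp_lfunE.
exists f => // psi x.
rewrite fE -[in LHS](dual_basis_ad db psi) !linear_sum ad_sum.
by apply: eq_bigr => i _; rewrite /= gh ad_act ad_hom smul_opp.
Qed.

(** A map into [P] composes to zero with every linear form, and the forms on a projective separate
    points. *)
Lemma zero_hom_projective M P :
  zero_hom M (reg s) -> is_projective P -> zero_hom M P.
Proof.
move=> z projP f fh; apply/lfunP => x; rewrite zero_lfunE.
apply: projective_separated => // phi.
by rewrite -comp_lfunE (z _ (is_hom_comp (ad_funP phi) fh)) zero_lfunE.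
Qed.

Definition resolution (P1 P0 M : kqmod s) (f : 'Hom(P1, P0)) (p : 'Hom(P0, M)) :=
  [/\ is_projective P1, is_projective P0, injective_hom f, surjective_hom p
    & forall y, p y = 0 <-> exists x, y = f x].

Definition dual_coker (P1 P0 : kqmod s) (f : 'Hom(P1, P0))
    (C : kqmod (opp_side s)) (c : 'Hom(algebra_dual P1, C)) :=
  surjective_hom c /\
  forall h : algebra_dual P1,
    c h = 0 <-> exists g, forall x, ad_fun h x = ad_fun g (f x).

(** The transpose computed from an arbitrary projective resolution of length one. It agrees with
    [is_transpose] by [is_transposeP], and it can be applied to the resolutions that arise in later
    arguments, where minimality would be lost. *)
Definition has_transpose (M : kqmod s) (C : kqmod (opp_side s)) :=
  exists (P1 P0 : kqmod s) (f : 'Hom(P1, P0)) (p : 'Hom(P0, M))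
    (c : 'Hom(algebra_dual P1, C)), resolution f p /\ dual_coker f c.

Lemma minimal_resolution (P1 P0 M : kqmod s) (f : 'Hom(P1, P0)) (p : 'Hom(P0, M)) :
  minimal_projective_presentation f p -> resolution f p.
Proof.
case=> -[proj1 proj0] fh ps /limg_lkerP ex [sf _]; split=> //; split=> //.
have [N [q [i [qs ii iq]]]] := image_ex fh.
have projN : is_projective N.
  exact: injective_hom_projective (ii) proj0.
have [r rh qr] := projN _ _ _ _ qs (@is_hom_id _ _ _ N).
have qrK x : q (r x) = x by rewrite -comp_lfunE qr id_lfunE.
apply/lfun_injP => x fx.
have : x \in limg r.
  rewrite (sf (limg r)) ?memvf //.
    by move=> a y /memv_imgP[z _ ->]; rewrite -rh memv_img ?memvf.
  apply/vspaceP => y; rewrite memvf -[y](subrK (r (q y))) memv_add //.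
    by rewrite memv_ker linearB /= -!iq qrK subrr.
  by rewrite memv_img ?memvf.
case/memv_imgP => y _ xy; move: fx; rewrite xy -iq qrK => iy.
by rewrite (_ : y = 0) ?linear0 //; apply: (lfun_injP i).1 iy; case: ii.
Qed.

(* Over a hereditary algebra, a projective of least dimension mapping onto [M]
   is a projective cover: a submodule still mapping onto [M] is projective. *)
Lemma projective_cover M : exists (P : kqmod s) (p : 'Hom(P, M)),
  [/\ is_projective P, surjective_hom p & superfluous (lker p)].
Proof.
have [P [p [projP ps]]] := enough_projectives M.
have [n le_n] := ubnP (\dim {:P}); elim: n => // n IHn in P p projP ps le_n *.
case: (classic (superfluous (lker p))) => [|nsup]; first by exists P, p.
have [V nV] := not_all_ex_not _ _ nsup.
have [sV {}nV] := imply_to_and _ _ nV; have [VP {}nV] := imply_to_and _ _ nV.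
have [L [i [ii Vi]]] := submodule_ex sV.
apply: (IHn L (p \o i)%VF).
- exact: injective_hom_projective ii projP.
- have [ph pP] := (surjective_homP p).1 ps.
  apply/surjective_homP; split=> [|y]; first exact: is_hom_comp ii.1.
  have [x <-] := pP y; have : x \in (lker p + V)%VS by rewrite VP memvf.
  case/memv_addP => k kp [v vV ->].
  move: vV; rewrite -Vi => /memv_imgP[t _ ->]; exists t.
  by rewrite comp_lfunE linearD /= (eqP (etrans (esym (memv_ker _ _)) kp)) add0r.
- have dV : (\dim V < \dim {:P})%N.
    rewrite ltn_neqAle dimvS ?subvf // andbT; apply/eqP => dV; apply: nV.
    by apply/eqP; rewrite eqEdim subvf dV leqnn.
  have -> : \dim {:L} = \dim V.
    rewrite -Vi limg_dim_eq //; apply/eqP; rewrite -subv0; apply/subvP => x.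
    rewrite memv_cap memv_ker => /andP[_ /eqP ix].
    by have -> : x = 0; [apply: (lfun_injP i).1 ix; case: ii|exact: mem0v].
  exact: leq_trans dV le_n.
Qed.

Lemma minimal_presentation_ex M :
  exists (P1 P0 : kqmod s) (f : 'Hom(P1, P0)) (p : 'Hom(P0, M)),
    minimal_projective_presentation f p.
Proof.
have [P0 [p [proj0 ps sp]]] := projective_cover M.
have [P1 [f [fi /limg_lkerP fp]]] := kernel_ex ps.1.
exists P1, P0, f, p; split=> //; last split=> //.
- by split=> //; apply: injective_hom_projective fi proj0.
- by case: fi.
- move=> V _; have /lker0P/eqP -> : injective f by case: fi.
  by rewrite add0v.
Qed.

Lemma resolution_lift (P1 P0 M R1 R0 N : kqmod s) (f : 'Hom(P1, P0))
    (p : 'Hom(P0, M)) (g : 'Hom(R1, R0)) (q : 'Hom(R0, N)) (u : 'Hom(M, N)) :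
  resolution f p -> resolution g q -> is_hom u ->
  exists (u0 : 'Hom(P0, R0)) (u1 : 'Hom(P1, R1)),
    [/\ is_hom u0, is_hom u1, forall x, q (u0 x) = u (p x)
      & forall x, g (u1 x) = u0 (f x)].
Proof.
move=> [_ proj0 [fh _] [ph _] fp] [_ _ gi qs gq] uh.
have [u0 u0h qu0] := proj0 _ _ _ _ qs (is_hom_comp uh ph).
have qu0E x : q (u0 x) = u (p x) by rewrite -!comp_lfunE qu0.
have [|u1 u1h gu1] := factor_inj gi (is_hom_comp u0h fh).
  move=> x; apply/gq; rewrite comp_lfunE qu0E (_ : p (f x) = 0) ?linear0 //.
  by apply/fp; exists x.
by exists u0, u1; split=> // x; rewrite gu1 comp_lfunE.
Qed.

(** The map [u0 - \1] lands in the kernel of [p], which is the image of [f]; it therefore factors as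
    [f \o k], and [f] can be cancelled. *)
Lemma resolution_homotopy (P1 P0 M : kqmod s) (f : 'Hom(P1, P0))
    (p : 'Hom(P0, M)) (u0 : 'End(P0)) (u1 : 'End(P1)) :
  resolution f p -> is_hom u0 -> is_hom u1 ->
  (forall x, p (u0 x) = p x) -> (forall x, f (u1 x) = u0 (f x)) ->
  exists2 k : 'Hom(P0, P1), is_hom k & forall x, u1 x = x + k (f x).
Proof.
move=> [_ _ fi _ fp] u0h u1h pu0 fu1.
have [||k kh fk] := @factor_inj _ _ _ _ _ _ f (u0 - \1)%VF fi.
- by move=> a x; rewrite !(add_lfunE, opp_lfunE, id_lfunE) u0h linearB.
- move=> x; apply/fp.
  by rewrite !(add_lfunE, opp_lfunE, id_lfunE) linearB /= pu0 subrr.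
exists k => // x; apply: fi.2; rewrite linearD /= fk fu1.
by rewrite add_lfunE opp_lfunE id_lfunE addrC subrK.
Qed.

(** Two resolutions of [M] are homotopy equivalent. After dualising, each homotopy contributes a
    form that factors through [f] or [f'], and such forms vanish in the cokernel. *)
Lemma is_transposeP M C : is_transpose M C <-> has_transpose M C.
Proof.
split=> [[P1 [P0 [f [p [c [/minimal_resolution fp cs ck]]]]]]|].
  exists P1, P0, f, p, c; split=> //; split=> // h; rewrite ck.
  split=> -[g hg]; exists g; first by move=> x; rewrite /ad_fun hg comp_lfunE.
  by apply/lfunP => x; rewrite comp_lfunE; apply: hg.
case=> P1 [P0 [f [p [c [res [cs ck]]]]]].
have [P1' [P0' [f' [p' mfp]]]] := minimal_presentation_ex M.
have res' := minimal_resolution mfp.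
have [u0 [u1 [u0h u1h pu fu]]] := resolution_lift res' res (@is_hom_id _ _ _ M).
have [v0 [v1 [v0h v1h pv fv]]] := resolution_lift res res' (@is_hom_id _ _ _ M).
have [||x|x|k kh kE] := @resolution_homotopy _ _ _ _ _
  (u0 \o v0)%VF (u1 \o v1)%VF res.
- exact: is_hom_comp.
- exact: is_hom_comp.
- by rewrite comp_lfunE pu id_lfunE pv id_lfunE.
- by rewrite !comp_lfunE fu fv.
have [||x|x|k' kh' kE'] := @resolution_homotopy _ _ _ _ _
  (v0 \o u0)%VF (v1 \o u1)%VF res'.
- exact: is_hom_comp.
- exact: is_hom_comp.
- by rewrite comp_lfunE pv id_lfunE pu id_lfunE.
- by rewrite !comp_lfunE fv fu.
have [V Vh VE] := ad_map_ex v1h; have [U Uh UE] := ad_map_ex u1h.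
have [ch cP] := (surjective_homP c).1 cs.
(* [C] itself is kept; its new presentation is [c] after the dual of the comparison map [v1]. *)
exists P1', P0', f', p', (c \o V)%VF; split=> //.
  apply/surjective_homP; split=> [|y]; first exact: is_hom_comp.
  have [phi <-] := cP y; exists (U phi); rewrite comp_lfunE.
  apply/eqP; rewrite -subr_eq0 -linearB /=; apply/eqP/ck.
  have [k1 k1h k1E] := ad_map_ex kh; exists (k1 phi) => x.
  by rewrite ad_funD ad_funN VE UE -(comp_lfunE u1) kE linearD /= k1E addrC addKr.
move=> h; rewrite comp_lfunE; split=> [/ck[g gE]|[g gE]].
  have [k1 k1h k1E] := ad_map_ex kh'; have [u0' u0'h u0E] := ad_map_ex u0h.
  exists (- k1 h + u0' g); apply/lfunP => x; rewrite comp_lfunE -!/(ad_fun _).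
  rewrite ad_funD ad_funN k1E u0E -fu -gE VE -(comp_lfunE v1) kE' linearD /=.
  by rewrite addrC addrK.
apply/ck; have [v0' v0'h v0E] := ad_map_ex v0h; exists (v0' g) => x.
by rewrite VE v0E -fv /ad_fun gE comp_lfunE.
Qed.

End AlgebraDuality.
End Transpose.

(** * Transposes of maps and of exact sequences *)

Section TransposeTheory.
Variables (K : fieldType) (Q : acyclicQuiver).
Local Notation A := (path_algebra K Q).
Local Notation kqmod := (kqmod K Q).
Local Notation reg := (@regular_module K Q).

Section Side.
Variable s : side.
Implicit Types M N P R Z U V : kqmod s.
Implicit Types C D X : kqmod (opp_side s).

Lemma has_transpose_iso M N C D : isomorphic M N -> isomorphic C D ->
  has_transpose M C -> has_transpose N D.
Proof.
move=> /isoP[u [v [uh vh uK vK]]] [e [[eh ei] es]].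
case=> P1 [P0 [f [p [c [[proj1 proj0 fi ps fp] [cs ck]]]]]].
exists P1, P0, f, (u \o p)%VF, (e \o c)%VF; split.
  split=> //.
    apply: surjective_hom_comp ps; apply/surjective_homP; split=> // y.
    by exists (v y).
  move=> y; rewrite comp_lfunE -fp; split=> [upy|->]; last exact: linear0.
  by rewrite -[LHS]uK upy linear0.
split=> [|h]; first exact: surjective_hom_comp.
rewrite comp_lfunE -ck; split=> [|->]; last exact: linear0.
exact: (lfun_injP e).1.
Qed.

Lemma transpose_ex M : exists C, has_transpose M C.
Proof.
have [P1 [P0 [f [p /minimal_resolution fp]]]] := minimal_presentation_ex M.
have [_ _ [fh _] _ _] := fp; have [F Fh FE] := ad_map_ex fh.
have [C [c [cs ck]]] := cokernel_ex Fh.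
exists C, P1, P0, f, p, c; split=> //; split=> // h; apply: iff_trans (ck h) _.
split=> -[g gE]; exists g; first by move=> x; rewrite gE FE.
by apply: ad_ext => x; rewrite gE FE.
Qed.

(** By reflexivity a form on [C], pulled back along [c], is evaluation at some [x] in [P1]. It kills
    every form that factors through [f], so all forms vanish at [f x]; hence [f x = 0] and
    [x = 0]. *)
Lemma transpose_zero_hom M C : has_transpose M C ->
  zero_hom C (reg (opp_side s)).
Proof.
case=> P1 [P0 [f [p [c [[proj1 proj0 [fh fi] _ fp] [/surjective_homP[ch cs] ck]]]]]] u uh.
have [Phi PhiE] := ad_ex (is_hom_comp uh ch).
have [x xE] := ad_reflexive Phi proj1.
have x0 : x = 0.
  apply: fi; rewrite linear0; apply: projective_separated => // psi.
  have [F Fh FE] := ad_map_ex fh.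
  rewrite -FE -xE PhiE comp_lfunE (ck (F psi)).2 ?linear0 //.
  by exists psi => y; rewrite FE.
apply/lfunP => y; have [h <-] := cs y.
by rewrite zero_lfunE -comp_lfunE -PhiE xE x0 linear0.
Qed.

(* A map between transposes lifts to the dualised resolutions, hence comes from
   a map of resolutions in the opposite direction; the latter is homotopic to
   zero as soon as it induces zero on the modules. *)
Lemma zero_hom_transpose M N C D : has_transpose M C -> has_transpose N D ->
  zero_hom N M -> zero_hom C D.
Proof.
case=> P1 [P0 [f [p [c [[projP1 projP0 [fh fi] [ph _] fp]
  [/surjective_homP[ch cs] ck]]]]]].
case=> R1 [R0 [g [q [d [[projR1 projR0 [gh gi] qs gq] [ds dk]]]]]] z u uh.
have [al alh dal] := algebra_dual_projective projP1 ds (is_hom_comp uh ch).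
have [a1 a1h a1E] := ad_full projP1 alh.
have [F Fh FE] := ad_map_ex fh.
(* [F psi] dies in [C], so [al (F psi)] dies in [D] and therefore extends along [g] to a form on
   [R0]. *)
have lift psi : exists k : algebra_dual R0, forall y,
    ad_fun k (g y) = ad_fun psi (f (a1 y)).
  have [|k kE] := (dk (al (F psi))).1.
    rewrite -comp_lfunE dal comp_lfunE (ck (F psi)).2 ?linear0 //.
    by exists psi => x; rewrite FE.
  by exists k => y; rewrite -kE a1E FE.
have [n [b [phi db]]] := projective_dual_basis projP0.
have [k kE] := fin_all_exists (fun i => lift (phi i)).
(* The extended dual basis forms are the coordinates of [b0], which completes [a1] to a map of
   resolutions. *)
have [||b0 b0h b0E] := @hom_ex K Q s R0 P0
  (fun y => \sum_i act P0 (ad_fun (k i) y) (b i)).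
- move=> t x y; rewrite scaler_sumr -big_split; apply: eq_bigr => i _.
  by rewrite linearP linearP add_lfunE scale_lfunE.
- move=> a y; rewrite linear_sum; apply: eq_bigr => i _.
  by rewrite ad_hom act_mul comp_lfunE.
have b0g y : b0 (g y) = f (a1 y).
  by rewrite b0E -[RHS]db; apply: eq_bigr => i _; rewrite kE.
have [|v vh vq] := factor_surj qs (is_hom_comp ph b0h).
  move=> y /gq[x ->]; rewrite comp_lfunE b0g; apply/fp; by exists (a1 x).
have pb0 y : p (b0 y) = 0.
  by rewrite -comp_lfunE -vq (z v vh) zero_lfunE.
(* The induced map [v] is zero, so [b0] lands in the image of [f]; the factor [ga] is the null
   homotopy, and through it [a1] factors over [g]. *)
have [|ga gah gaE] := @factor_inj _ _ _ _ _ _ f b0 (conj fh fi) b0h.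
  by move=> y; apply/fp.
have ga1 y : ga (g y) = a1 y by apply: fi; rewrite gaE b0g.
apply/lfunP => y; have [h <-] := cs y.
rewrite zero_lfunE -comp_lfunE -dal comp_lfunE; apply/dk.
have [G Gh GE] := ad_map_ex gah; exists (G h) => x.
by rewrite a1E GE ga1.
Qed.

(* The torsion part of [M], where all linear forms to the algebra vanish, splits
   off: the quotient embeds into a free module, so it is projective. *)
Lemma torsionless_split M : exists Z P,
  [/\ zero_hom Z (reg s), is_projective P & isomorphic M (direct_sum Z P)].
Proof.
pose b := vbasis {:algebra_dual M}.
pose n := \dim {:algebra_dual M}.
have [||h hh hE] := @hom_ex K Q s M (free_module K Q s n)
  (fun x => [ffun i : 'I_n => ad_fun (b`_i : algebra_dual M) x] : {ffun 'I_n -> A}).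
- by move=> c x y; apply/ffunP => i; rewrite !ffunE linearP.
- by move=> a x; apply/ffunP => i; rewrite free_actE !ffunE ad_hom.
have [P [q [i [qs ii iq]]]] := image_ex hh.
have projP := injective_hom_projective ii (@free_projective K Q s n).
have [r rh qr] := projP _ _ _ _ qs (@is_hom_id _ _ _ P).
have qrK : cancel r q by move=> x; rewrite -comp_lfunE qr id_lfunE.
have [Z [j [jj qj]]] := kernel_ex qs.1.
have [||pi pih piE] := @factor_inj _ _ _ _ _ _ j (\1 - (r \o q))%VF jj.
- by move=> a x; rewrite !(add_lfunE, opp_lfunE, id_lfunE, comp_lfunE) qs.1 rh linearB.
- move=> x; apply/qj; rewrite !(add_lfunE, opp_lfunE, id_lfunE, comp_lfunE).
  by rewrite linearB /= qrK subrr.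
have jpi x : j (pi x) = x - r (q x).
  by rewrite piE !(add_lfunE, opp_lfunE, id_lfunE, comp_lfunE).
have qj0 x : q (j x) = 0 by apply/qj; exists x.
have jK : cancel j pi by move=> x; apply: jj.2; rewrite jpi qj0 linear0 subr0.
exists Z, P; split=> //; last first.
  apply: (iso_dsum jj.1 rh pih qs.1) => // x.
  by rewrite jpi subrK.
move=> u uh; apply/lfunP => x; rewrite zero_lfunE.
have [phi phiE] := ad_ex (is_hom_comp uh pih).
have -> : u x = ad_fun phi (j x) by rewrite phiE comp_lfunE jK.
have : h (j x) = 0 by rewrite -iq qj0 linear0.
rewrite hE => /ffunP b0; rewrite (coord_vbasis (memvf phi)) ad_sum big1 // => k _.
have /= := b0 k; rewrite !ffunE => bk.
by rewrite ad_funZ bk scaler0.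
Qed.

(* A resolution of [Z] dualises to one of its transpose if [Hom(Z, KQ) = 0], and
   the second dual of the resolution is the resolution. *)
Lemma transpose_sym Z C (Z' : kqmod (opp_side (opp_side s)))
    (e : 'Hom(Z, Z')) :
  bijective e -> (forall a x, e (act Z a x) = act Z' a (e x)) ->
  zero_hom Z (reg s) -> has_transpose Z C -> has_transpose C Z'.
Proof.
(* For a variable side, [Z] and [Z'] live over sides that are not convertible; a linear bijection
   respecting the actions replaces an isomorphism of modules. *)
move=> [e' eK e'K] eh z.
case=> P1 [P0 [f [p [c [[proj1 proj0 [fh fi] [ph ps] fp] [[ch cs] ck]]]]]].
have [F Fh FE] := ad_map_ex fh.
have ev0 x : exists Phi : algebra_dual (algebra_dual P0),
  forall phi : algebra_dual P0, ad_fun Phi phi = ad_fun phi x by apply: ev_ex.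
have uniq0 x y : (forall phi : algebra_dual P0, ad_fun phi x = ad_fun phi y) -> x = y.
  move=> xy; apply/eqP; rewrite -subr_eq0; apply/eqP/projective_separated => // phi.
  by rewrite linearB /= xy subrr.
have inv (Phi : algebra_dual (algebra_dual P0)) :
    {x | forall phi : algebra_dual P0, ad_fun Phi phi = ad_fun phi x}.
  exact/constructive_indefinite_description/ad_reflexive.
(* The second dual of [p]: the inverse of evaluation on [P0], followed by [p] and the identification
   [e]. *)
have [||c' c'h c'E] := @hom_ex K Q _ (algebra_dual (algebra_dual P0)) Z'
  (fun Phi => e (p (sval (inv Phi)))).
- move=> t Phi Psi; rewrite -!linearP; congr (e (p _)); apply: uniq0 => phi.
  rewrite [RHS]linearP /= -(svalP (inv Phi)) -(svalP (inv Psi)).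
  by rewrite -(svalP (inv _)) ad_linear.
- move=> a Phi; rewrite -eh -ph; congr (e (p _)); apply: uniq0 => phi.
  by rewrite ad_hom -!(svalP (inv _)) ad_act !smul_opp.
exists (algebra_dual P0), (algebra_dual P1), F, c, c'; split.
  split=> //; try exact: algebra_dual_projective.
    (* A form on [P0] that vanishes on the image of [f] descends to [Z], where every form is
       zero. *)
    split=> //; apply/lfun_injP => psi Fpsi; apply: ad_ext => y; rewrite ad_fun0.
    have [|v vh vE] := factor_surj (conj ph ps) (ad_funP psi).
      by move=> x /fp[x' ->]; rewrite -FE Fpsi ad_fun0.
    by rewrite -vE (z v vh) zero_lfunE.
  move=> h; apply: iff_trans (ck h) _; split=> -[g gE]; exists g.
    by apply: ad_ext => x; rewrite gE FE.
  by move=> x; rewrite gE FE.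
split.
  apply/surjective_homP; split=> // y.
  have [x xE] := (limg_fullP p).1 ps (e' y); have [Phi PhiE] := ev0 x.
  exists Phi; rewrite c'E -[RHS]e'K -xE; congr (e (p _)); apply: uniq0 => phi.
  by rewrite -(svalP (inv _)).
move=> Phi; rewrite c'E; move: (svalP (inv Phi)); move: (sval _) => x xE.
have -> : (e (p x) = 0) <-> p x = 0.
  split=> [epx|->]; last exact: linear0.
  by rewrite -[LHS]eK epx -(linear0 e) eK.
apply: iff_trans (fp x) _; split=> [[y xy]|[Psi PsiE]].
  have [Psi PsiE] := ev_ex y; exists Psi => phi.
  by rewrite xE xy PsiE FE.
have [y yE] := ad_reflexive Psi proj1; exists y; apply: uniq0 => phi.
by rewrite -xE PsiE yE FE.
Qed.

(* For a projective presentation [P0 -> C] put [W = ker (P0 -> V)]; then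
   [P1 -> W] resolves [U], [W -> P0] resolves [V], and the cokernels of the
   composable pair of dual maps form the sequence [Tr V -> Tr C -> Tr U]. *)
Lemma transpose_exact U N V D (i : 'Hom(U, N)) (q : 'Hom(N, V)) :
  injective_hom i -> surjective_hom q -> (forall y, q y = 0 <-> exists x, y = i x) ->
  zero_hom U (reg s) -> has_transpose N D ->
  exists X1 X2 (i' : 'Hom(X1, D)) (q' : 'Hom(D, X2)),
    [/\ has_transpose V X1, has_transpose U X2, injective_hom i',
        surjective_hom q' & forall y, q' y = 0 <-> exists x, y = i' x].
Proof.
move=> ii qs qi z.
case=> P1 [P0 [f [p [c [[proj1 proj0 [fh fi] [ph ps] fp] [cs ck]]]]]].
have [qph qps] := surjective_hom_comp qs (conj ph ps).
have [W [w [wi qw]]] := kernel_ex qph.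
have projW := injective_hom_projective wi proj0.
have [|r rh wr] := @factor_inj _ _ _ _ _ _ w f wi fh.
  move=> x; apply/qw; rewrite comp_lfunE (_ : p (f x) = 0) ?linear0 //.
  by apply/fp; exists x.
have ri : injective r by move=> x y rxy; apply: fi; rewrite -!wr rxy.
have [||u uh uE] := @factor_inj _ _ _ _ _ _ i (p \o w)%VF ii.
- by apply: is_hom_comp wi.1.
- by move=> t; apply/qi; rewrite comp_lfunE -comp_lfunE; apply/qw; exists t.
have us : surjective_hom u.
  apply/surjective_homP; split=> // y.
  have [x px] := (limg_fullP p).1 ps (i y).
  have [|t xt] := (qw x).1; first by rewrite comp_lfunE px; apply/qi; exists y.
  by exists t; apply: ii.2; rewrite uE comp_lfunE -xt.
have ur y : u y = 0 <-> exists x, y = r x.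
  split=> [uy|[x ->]].
    have [|x wx] := (fp (w y)).1; first by rewrite -comp_lfunE -uE uy linear0.
    by exists x; apply: wi.2; rewrite wx wr.
  apply: ii.2; rewrite uE linear0 comp_lfunE wr.
  by apply/fp; exists x.
have [R Rh RE] := ad_map_ex rh; have [ww wwh wwE] := ad_map_ex wi.1.
(* [X1] is taken as the image of the dual of [W] in [D], which makes [i'] injective at once; that it
   is the transpose of [V] then has to be checked. *)
have [X1 [c1 [i' [c1s i'i i'c1]]]] := image_ex (is_hom_comp cs.1 Rh).
have [X2 [q' [q's q'i]]] := cokernel_ex i'i.1.
exists X1, X2, i', q'; split=> //.
- exists W, P0, w, (q \o p)%VF, c1; split; first by split.
  split=> // h; split=> [c1h|[g gE]]; last first.
    apply: i'i.2; rewrite i'c1 linear0 comp_lfunE; apply/ck; exists g => x.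
    by rewrite RE gE wr.
  have [|g gE] := (ck (R h)).1; first by rewrite -comp_lfunE -i'c1 c1h linear0.
  exists g => x; rewrite -wwE; apply/eqP; rewrite -subr_eq0; apply/eqP.
  (* The difference [h - ww g] vanishes on the image of [r], the kernel of [u], so it descends to
     [U] and is zero there. *)
  have [||v vh vE] := @factor_surj _ _ _ _ _ (reg s) u (ad_fun (h - ww g)) us.
  - exact: ad_funP.
  - by move=> _ /ur[y ->]; rewrite ad_funD ad_funN wwE wr -gE RE subrr.
  by rewrite -ad_funN -ad_funD -vE (z v vh) zero_lfunE.
exists P1, W, r, u, (q' \o c)%VF; split; first by split.
split=> [|h]; first exact: surjective_hom_comp.
rewrite comp_lfunE; apply: iff_trans (q'i (c h)) _; split=> [[x cx]|[g gE]].
  have [t tx] := (limg_fullP c1).1 c1s.2 x.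
  have [|g gE] := (ck (h - R t)).1.
    by rewrite linearB /= cx -tx i'c1 comp_lfunE subrr.
  exists (ww g + t) => y.
  by rewrite ad_funD wwE wr -gE ad_funD ad_funN RE subrK.
exists (c1 g); rewrite i'c1 comp_lfunE; apply/eqP; rewrite -subr_eq0 -linearB.
by rewrite (_ : h = R g) ?subrr ?linear0 //; apply: ad_ext => x; rewrite RE gE.
Qed.

End Side.
End TransposeTheory.

(** * Duality over the base field *)

(* For a concrete side, [opp_side (opp_side s)] reduces to [s] and [flip] to the
   identity. *)
Definition flip (K : fieldType) (Q : acyclicQuiver) (s : side) :
    kqmod K Q s -> kqmod K Q (opp_side (opp_side s)) :=
  if s is Left then fun M => M else fun M => M.

Section Duality.
Variables (K : fieldType) (Q : acyclicQuiver).
Local Notation A := (path_algebra K Q).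
Local Notation kqmod := (kqmod K Q).
Local Notation reg := (@regular_module K Q).

Lemma scalar_dual_basis (V : vectType K) : exists n (b : 'I_n -> V)
    (beta : 'I_n -> 'Hom(V, K^o)), forall x, \sum_i beta i x *: b i = x.
Proof.
pose b i := (vbasis {:V})`_i : V.
have coordh i : exists beta : 'Hom(V, K^o),
    beta =1 (fun x => coord (vbasis {:V}) i x : K^o).
  by apply: lfun_ex => c x y; rewrite linearP.
have [beta betaE] := fin_all_exists coordh.
exists (\dim {:V}), b, beta => x; rewrite [RHS](coord_vbasis (memvf x)).
by apply: eq_bigr => i _; rewrite betaE.
Qed.

Section Side.
Variable s : side.
Implicit Types L M N P I X : kqmod s.

Lemma dual_actE M a (phi : dual M) x :
  (act (dual M) a phi : 'Hom(M, K^o)) x = (phi : 'Hom(M, K^o)) (act M a x).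
Proof. by rewrite /= lfunE /= /precomp comp_lfunE. Qed.

Lemma dual_map_ex M N (f : 'Hom(M, N)) : is_hom f ->
  exists2 F : 'Hom(dual N, dual M), is_hom F
    & forall phi : 'Hom(N, K^o), F phi = (phi \o f)%VF.
Proof.
move=> fh; apply: (@hom_ex K Q (opp_side s) (dual N) (dual M)
  (fun phi : 'Hom(N, K^o) => (phi \o f)%VF)) => [c phi psi|a phi].
  by rewrite comp_lfunDl comp_lfunZl.
apply/lfunP => x; rewrite dual_actE !comp_lfunE.
by rewrite [LHS]dual_actE fh.
Qed.

(** The values of [G] on the coordinate forms of [N] are the coordinates of [g]; forms separate the
    points of [N], which makes [g] a homomorphism. *)
Lemma dual_full M N (G : 'Hom(dual N, dual M)) : is_hom G ->
  exists2 g : 'Hom(M, N), is_hom g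
    & forall phi : 'Hom(N, K^o), G phi = (phi \o g)%VF.
Proof.
have [n [b [beta bb]]] := scalar_dual_basis N; move=> Gh.
have GE (phi : 'Hom(N, K^o)) x : (G phi : 'Hom(M, K^o)) x =
    phi (\sum_i (G (beta i) : 'Hom(M, K^o)) x *: b i).
  have {1}-> : phi = \sum_i phi (b i) *: beta i.
    apply/lfunP => y; rewrite sum_lfunE -{1}(bb y) linear_sum.
    by apply: eq_bigr => i _; rewrite linearZ scale_lfunE [LHS]mulrC.
  rewrite !linear_sum sum_lfunE; apply: eq_bigr => i _.
  by rewrite !linearZ scale_lfunE [LHS]mulrC.
have sepN x y : (forall phi : 'Hom(N, K^o), phi x = phi y) -> x = y.
  by move=> xy; rewrite -(bb x) -(bb y); apply: eq_bigr => i _; rewrite xy.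
have [||g gh gE] := @hom_ex K Q s M N
    (fun x => \sum_i (G (beta i) : 'Hom(M, K^o)) x *: b i).
- move=> c x y; rewrite scaler_sumr -big_split; apply: eq_bigr => i _.
  by rewrite linearP scalerDl scalerA.
- move=> a x; apply: sepN => phi; rewrite -GE -dual_actE -Gh GE.
  by rewrite dual_actE.
by exists g => // phi; apply/lfunP => x; rewrite comp_lfunE gE GE.
Qed.

Lemma dual_faithful M N (f g : 'Hom(M, N)) :
  (forall phi : 'Hom(N, K^o), (phi \o f)%VF = (phi \o g)%VF) -> f = g.
Proof.
have [n [b [beta bb]]] := scalar_dual_basis N; move=> fg.
apply/lfunP => x; rewrite -(bb (f x)) -(bb (g x)); apply: eq_bigr => i _.
by rewrite -!comp_lfunE fg.
Qed.

Lemma dual_inj M N (f : 'Hom(M, N)) (F : 'Hom(dual N, dual M)) :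
  surjective_hom f -> is_hom F ->
  (forall phi : 'Hom(N, K^o), F phi = (phi \o f)%VF) -> injective_hom F.
Proof.
move=> /surjective_homP[fh fs] Fh FE; split=> // phi psi.
rewrite !FE => /lfunP e; apply/lfunP => y; have [x <-] := fs y.
by have := e x; rewrite !comp_lfunE.
Qed.

Lemma dual_surj M N (f : 'Hom(M, N)) (F : 'Hom(dual N, dual M)) :
  injective_hom f -> is_hom F ->
  (forall phi : 'Hom(N, K^o), F phi = (phi \o f)%VF) -> surjective_hom F.
Proof.
move=> [fh fi] Fh FE; apply/surjective_homP; split=> // phi.
exists ((phi : 'Hom(M, K^o)) \o f^-1)%VF; rewrite FE; apply/lfunP => x.
by rewrite !comp_lfunE lker0_lfunK //; apply/lker0P.
Qed.

Lemma dual_exact L M N (i : 'Hom(L, M)) (q : 'Hom(M, N))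
    (I : 'Hom(dual M, dual L)) (R : 'Hom(dual N, dual M)) :
  surjective_hom q -> limg i = lker q ->
  (forall phi : 'Hom(M, K^o), I phi = (phi \o i)%VF) ->
  (forall phi : 'Hom(N, K^o), R phi = (phi \o q)%VF) -> limg R = lker I.
Proof.
move=> [qh qs] /limg_lkerP iq IE RE; apply/limg_lkerP => phi.
rewrite IE; split=> [phi0|[psi ->]]; last first.
  rewrite RE; apply/lfunP => x; rewrite !comp_lfunE zero_lfunE.
  by rewrite (iq (i x)).2 ?linear0 //; exists x.
exists ((phi : 'Hom(M, K^o)) \o q^-1)%VF; rewrite RE; apply/lfunP => x.
apply/eqP; rewrite !comp_lfunE -subr_eq0 -linearB; apply/eqP.
have [|y ->] := (iq (x - (q^-1)%VF (q x))).1.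
  by rewrite linearB /= limg_lfunVK ?subrr // qs memvf.
by rewrite /= -comp_lfunE phi0 zero_lfunE.
Qed.

Lemma dual_iso M N : isomorphic M N -> isomorphic (dual M) (dual N).
Proof.
move=> /iso_sym[f [fi fs]]; have [F Fh FE] := dual_map_ex fi.1.
by exists F; split; [apply: dual_inj FE|apply: dual_surj FE].
Qed.

Lemma dual_dsum M N :
  isomorphic (dual (direct_sum M N)) (direct_sum (dual M) (dual N)).
Proof.
have [i [j [p [q [[ih jh ph qh] [iE jE pE qE]]]]]] := dsum_maps M N.
have [I Ih IE] := dual_map_ex ih; have [J Jh JE] := dual_map_ex jh.
have [P Ph PE] := dual_map_ex ph; have [R Rh RE] := dual_map_ex qh.
apply: (iso_dsum Ph Rh Ih Jh) => phi.
- by rewrite IE PE; apply/lfunP => x; rewrite !comp_lfunE iE pE.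
- by rewrite JE RE; apply/lfunP => x; rewrite !comp_lfunE jE qE.
rewrite IE JE PE RE; apply/lfunP => z; rewrite add_lfunE !comp_lfunE -linearD.
rewrite pE qE iE jE; congr (fun_of_lfun _ _); case: z => x y.
by apply/eqP; rewrite -pair_eqE /= addr0 add0r !eqxx.
Qed.

End Side.

Lemma bidual_ex s (M : kqmod s) : exists2 e : 'Hom(M, dual (dual M)), bijective e
  & forall a x, e (act M a x) = act (dual (dual M)) a (e x).
Proof.
have [n [b [beta bb]]] := scalar_dual_basis M.
have ev0 x : exists Phi : 'Hom('Hom(M, K^o), K^o), forall phi, Phi phi = phi x.
  by apply: lfun_ex => c phi psi; rewrite add_lfunE scale_lfunE.
have ev x := constructive_indefinite_description _ (ev0 x).
have [|e eE] := @lfun_ex K M (dual (dual M)) (fun x => sval (ev x)).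
  move=> c x y; apply/lfunP => phi; rewrite add_lfunE scale_lfunE.
  by rewrite !(svalP (ev _)) linearP.
have eP x (phi : 'Hom(M, K^o)) : (e x : 'Hom('Hom(M, K^o), K^o)) phi = phi x.
  by rewrite eE (svalP (ev x)).
exists e.
  exists (fun Phi : 'Hom('Hom(M, K^o), K^o) => \sum_i Phi (beta i) *: b i) => [x|Phi].
    by rewrite -[RHS]bb; apply: eq_bigr => i _; rewrite eP.
  apply/lfunP => phi; rewrite eP linear_sum.
  have {2}-> : phi = \sum_i phi (b i) *: beta i.
    apply/lfunP => y; rewrite sum_lfunE -{1}(bb y) linear_sum.
    by apply: eq_bigr => i _; rewrite linearZ scale_lfunE [LHS]mulrC.
  rewrite linear_sum; apply: eq_bigr => i _.
  by rewrite !linearZ [LHS]mulrC.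
move=> a x; apply/lfunP => phi; rewrite eP.
by rewrite [RHS](dual_actE a (e x)) eP [RHS]dual_actE.
Qed.


Lemma bidual_iso s (M : kqmod s) : isomorphic (flip M) (dual (dual M)).
Proof.
have [e [e' eK e'K] eh] := bidual_ex M.
case: s M e e' eK e'K eh => M e e' eK e'K eh; exists e;
  split; try (by split=> //; apply: can_inj eK);
  by apply/surjective_homP; split=> // y; exists (e' y).
Qed.

Lemma dual_ess s (M : kqmod (opp_side s)) :
  exists N : kqmod s, isomorphic M (dual N).
Proof. by case: s M => M; exists (dual M); apply: (bidual_iso M). Qed.

(** A copy of [M] embeds into [M], so the result on submodules of projectives applies. *)
Lemma projective_iso s (M N : kqmod s) :
  isomorphic M N -> is_projective M -> is_projective N.
Proof. by move=> /iso_sym[f [fi _]]; apply: injective_hom_projective fi. Qed.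

Lemma injective_iso s (M N : kqmod s) :
  isomorphic M N -> is_injective M -> is_injective N.
Proof.
move=> /isoP[u [v [uh vh uK vK]]] injM X Y g f gi fh.
have [h hh hE] := injM _ _ _ _ gi (is_hom_comp vh fh).
exists (u \o h)%VF; first exact: is_hom_comp.
by rewrite -comp_lfunA hE; apply/lfunP => x; rewrite !comp_lfunE vK.
Qed.

(** Duality turns the extension problem for [N] into a lifting problem for its dual; fullness and
    faithfulness bring the solution back. *)
Lemma injective_of_dual s (N : kqmod s) :
  is_projective (dual N) -> is_injective N.
Proof.
move=> projN X Y g f gi fh.
have [G Gh GE] := dual_map_ex gi.1; have [F Fh FE] := dual_map_ex fh.
have [H Hh GH] := projN _ _ _ _ (dual_surj gi Gh GE) Fh.
have [h hh hE] := dual_full Hh; exists h => //.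
apply: dual_faithful => phi; rewrite comp_lfunA -hE -GE -FE -GH.
by rewrite comp_lfunE.
Qed.

Lemma projective_of_dual s (N : kqmod s) :
  is_injective (dual N) -> is_projective N.
Proof.
move=> injN X Y g f gs fh.
have [G Gh GE] := dual_map_ex gs.1; have [F Fh FE] := dual_map_ex fh.
have [H Hh GH] := injN _ _ _ _ (dual_inj gs Gh GE) Fh.
have [h hh hE] := dual_full Hh; exists h => //.
apply: dual_faithful => phi; rewrite comp_lfunA -GE -hE -FE -GH.
by rewrite comp_lfunE.
Qed.

Lemma dual_projective s (N : kqmod s) :
  is_injective N -> is_projective (dual N).
Proof.
move=> injN; apply: projective_of_dual.
have := bidual_iso N; case: s N injN => N injN e; exact: injective_iso e injN.
Qed.

Lemma dual_injective s (N : kqmod s) :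
  is_projective N -> is_injective (dual N).
Proof.
move=> projN; apply: injective_of_dual.
have := bidual_iso N; case: s N projN => N projN e; exact: projective_iso e projN.
Qed.

End Duality.

(** * Torsion pairs *)

Section TorsionPairs.
Variables (K : fieldType) (Q : acyclicQuiver).
Local Notation kqmod := (kqmod K Q).
Local Notation reg := (@regular_module K Q).
Local Notation subcat_pair s := ((kqmod s -> Prop) * (kqmod s -> Prop))%type.

Definition dsum_class s (D E : kqmod s -> Prop) : kqmod s -> Prop :=
  fun N => exists M1 M2, [/\ D M1, E M2 & isomorphic N (direct_sum M1 M2)].

Definition dual_class s (D : kqmod s -> Prop) : kqmod (opp_side s) -> Prop :=
  fun N => exists2 M, D M & isomorphic N (dual M).

Definition transpose_class s (D : kqmod s -> Prop) : kqmod (opp_side s) -> Prop :=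
  fun C => exists2 M, D M & has_transpose M C.

Definition torsion_pair s (TF : subcat_pair s) :=
  [/\ forall M N, isomorphic M N -> TF.1 M -> TF.1 N,
      forall M N, isomorphic M N -> TF.2 M -> TF.2 N,
      forall X Y, TF.1 X -> TF.2 Y -> zero_hom X Y
    & forall X : kqmod s, exists (X1 X2 : kqmod s)
        (i : 'Hom(X1, X)) (q : 'Hom(X, X2)),
        [/\ TF.1 X1, TF.2 X2, injective_hom i, surjective_hom q
          & limg i = lker q]].

Definition dual_pair s (TF : subcat_pair s) : subcat_pair (opp_side s) :=
  (dual_class TF.2, dual_class TF.1).

(** Transposes admit no nonzero map to a projective, so the projectives are added to the
    torsion-free class by hand. *)
Definition transpose_pair s (TF : subcat_pair s) : subcat_pair (opp_side s) :=
  (transpose_class TF.2,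
   dsum_class (transpose_class TF.1) (@is_projective K Q (opp_side s))).

Section Side.
Variable s : side.

Lemma regular_projective : is_projective (reg s).
Proof.
have [phi phiE] := ad_ex (@is_hom_id _ _ _ (reg s)).
apply: (@dual_basis_projective K Q s (reg s) 1 (fun=> 1) (fun=> phi)) => y.
by rewrite big_ord1 reg_actE smulr1 phiE id_lfunE.
Qed.

Lemma dsum_iso (M N M' N' : kqmod s) : isomorphic M M' -> isomorphic N N' ->
  isomorphic (direct_sum M N) (direct_sum M' N').
Proof.
move=> /isoP[f [f' [fh f'h fK f'K]]] /isoP[g [g' [gh g'h gK g'K]]].
have [i [j [p [q [[ih jh ph qh] [iE jE pE qE]]]]]] := dsum_maps M N.
apply: (@iso_dsum _ _ _ _ _ _ (i \o f') (j \o g') (f \o p) (g \o q))%VF;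
  try exact: is_hom_comp.
- by move=> x; rewrite !comp_lfunE iE pE f'K.
- by move=> x; rewrite !comp_lfunE jE qE g'K.
move=> z; rewrite !comp_lfunE fK gK iE jE pE qE; case: z => x y.
by apply/eqP; rewrite -pair_eqE /= addr0 add0r !eqxx.
Qed.

Lemma dsumC_iso (M N : kqmod s) :
  isomorphic (direct_sum M N) (direct_sum N M).
Proof.
have [i [j [p [q [[ih jh ph qh] [iE jE pE qE]]]]]] := dsum_maps M N.
apply: (iso_dsum jh ih qh ph) => [x|x|[x y]].
- by rewrite jE qE.
- by rewrite iE pE.
by rewrite iE jE pE qE; apply/eqP; rewrite -pair_eqE /= addr0 add0r !eqxx.
Qed.

Lemma dsum0_iso (M Z : kqmod s) : (forall x : Z, x = 0) ->
  isomorphic M (direct_sum M Z).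
Proof.
move=> Z0; apply: (@iso_dsum _ _ _ _ _ _ \1%VF (0 : 'Hom(Z, M)) \1%VF 0).
- exact: is_hom_id.
- exact: is_hom0.
- exact: is_hom_id.
- exact: is_hom0.
- by move=> x; rewrite !id_lfunE.
- by move=> x; rewrite [LHS]Z0 [RHS]Z0.
- by move=> x; rewrite !id_lfunE !zero_lfunE addr0.
Qed.

Lemma zero_projective_ex :
  exists2 P : kqmod s, is_projective P & forall x : P, x = 0.
Proof.
exists (free_module K Q s 0); first exact: free_projective.
by move=> x; apply/ffunP => -[].
Qed.

(** The torsion part of [X] maps to zero in [Y], hence vanishes, and [X] is its own torsion-free
    quotient. *)
Lemma torsion_pair_sub (TF : subcat_pair s) (X Y : kqmod s) (j : 'Hom(X, Y)) :
  torsion_pair TF -> injective_hom j -> TF.2 Y -> TF.2 X.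
Proof.
case=> isoT isoF TF0 seq jj FY; have [X1 [X2 [i [q [TX1 FX2 ii qs iq]]]]] := seq X.
apply: isoF FX2; apply: iso_sym; exists q; split=> //; split; first by case: qs.
have ji0 := TF0 _ _ TX1 FY _ (is_hom_comp jj.1 ii.1).
apply/lfun_injP => x /((limg_lkerP i q).1 iq)[y ->].
by apply: jj.2; rewrite -comp_lfunE ji0 zero_lfunE linear0.
Qed.

(** Enlarging one class shrinks the other: an [X] in the larger torsion class has only zero maps to
    its torsion-free quotient for [TF], so it equals its torsion part. The other class is dual. *)
Lemma torsion_pair_eq (TF TF' : subcat_pair s) :
  torsion_pair TF -> torsion_pair TF' ->
  (forall X, TF.1 X -> TF'.1 X) -> (forall X, TF.2 X -> TF'.2 X) -> TF = TF'.
Proof.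
move=> [isoT isoF _ seq] [_ _ TF0 _] sT sF.
have T'T X : TF'.1 X -> TF.1 X.
  move=> T'X; have [X1 [X2 [i [q [TX1 FX2 ii qs /limg_lkerP iq]]]]] := seq X.
  apply: isoT TX1; exists i; split=> //; apply/surjective_homP.
  split; first by case: ii.
  move=> x; have [|y ->] := (iq x).1; last by exists y.
  by rewrite (TF0 _ _ T'X (sF _ FX2) q qs.1) zero_lfunE.
have F'F X : TF'.2 X -> TF.2 X.
  move=> F'X; have [X1 [X2 [i [q [TX1 FX2 ii qs /limg_lkerP iq]]]]] := seq X.
  apply: isoF FX2; apply: iso_sym; exists q; split=> //; split; first by case: qs.
  apply/lfun_injP => x /iq[y ->].
  by rewrite (TF0 _ _ (sT _ TX1) F'X i ii.1) zero_lfunE.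
rewrite [TF]surjective_pairing [TF']surjective_pairing.
by congr pair; apply: functional_extensionality => X;
  apply: propositional_extensionality; split; auto.
Qed.

Lemma dual_pair_torsion (TF : subcat_pair s) :
  torsion_pair TF -> torsion_pair (dual_pair TF).
Proof.
case=> isoT isoF TF0 seq; split=> /=.
- move=> M N MN [X FX MX]; exists X => //; exact: iso_trans (iso_sym MN) MX.
- move=> M N MN [X TX MX]; exists X => //; exact: iso_trans (iso_sym MN) MX.
- move=> X Y [Y' FY' XY'] [X' TX' YX'].
  apply: zero_hom_iso (iso_sym XY') (iso_sym YX') _ => f fh.
  have [g gh gE] := dual_full fh; apply/lfunP => phi.
  by rewrite gE (TF0 _ _ TX' FY' g gh) comp_lfun0r zero_lfunE.
move=> Y; have [X YX] := dual_ess Y.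
have [X1 [X2 [i [q [TX1 FX2 ii qs iq]]]]] := seq X.
have [I Ih IE] := dual_map_ex ii.1; have [R Rh RE] := dual_map_ex qs.1.
have /isoP[u [v [uh vh uK vK]]] := YX.
have Ri := dual_inj qs Rh RE; have Is := dual_surj ii Ih IE.
have /limg_lkerP RI := dual_exact qs iq IE RE.
exists (dual X2), (dual X1), (v \o R)%VF, (I \o u)%VF; split.
- by exists X2 => //; apply: iso_refl.
- by exists X1 => //; apply: iso_refl.
- by apply: injective_hom_comp Ri; split=> //; apply: can_inj vK.
- apply: surjective_hom_comp Is _; apply/surjective_homP; split=> // y.
  by exists (v y).
apply/limg_lkerP => y; rewrite comp_lfunE; apply: iff_trans (RI (u y)) _.
split=> -[x xE]; exists x; first by rewrite comp_lfunE -xE uK.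
by rewrite xE comp_lfunE vK.
Qed.

Lemma transpose_inv_ex (Z : kqmod s) : zero_hom Z (reg s) ->
  exists C : kqmod (opp_side s), has_transpose Z C /\ has_transpose C (flip Z).
Proof.
move=> z; have [C ZC] := transpose_ex Z; exists C; split=> //.
have bij : bijective (\1%VF : 'End(Z)).
  by exists id => x; rewrite id_lfunE.
have eh a x : (\1%VF : 'End(Z)) (act Z a x) = act Z a ((\1%VF : 'End(Z)) x).
  by rewrite !id_lfunE.
(* Once the side is concrete, [flip Z] reduces to [Z] and the identity can play the part of [e]. *)
move: s Z z C ZC bij eh => [] Z z C ZC bij eh.
  exact: (@transpose_sym K Q Left Z C Z _ bij eh z ZC).
exact: (@transpose_sym K Q Right Z C Z _ bij eh z ZC).
Qed.

End Side.

Lemma transpose_pre_ex s (Z : kqmod (opp_side s)) : zero_hom Z (reg (opp_side s)) ->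
  exists C : kqmod s, has_transpose C Z.
Proof. by case: s Z => Z /transpose_inv_ex[C [_ CZ]]; exists C. Qed.

Lemma transpose_pair_torsion s (TF : subcat_pair s) :
  torsion_pair TF -> (forall P, is_projective P -> TF.2 P) ->
  torsion_pair (transpose_pair TF) /\
  (forall P, is_projective P -> (transpose_pair TF).2 P).
Proof.
move=> [isoT isoF TF0 seq] projF.
have tp : torsion_pair (transpose_pair TF).
  split=> /=.
  - move=> M N MN [X FX XM]; exists X => //.
    exact: has_transpose_iso (iso_refl X) MN XM.
  - move=> M N MN [X [P [TX projP MXP]]]; exists X, P; split=> //.
    exact: iso_trans (iso_sym MN) MXP.
  - move=> X Y [Y0 FY0 YX] [X1 [P [[X0 TX0 XX1] projP YXP]]].
    apply: zero_hom_iso (iso_refl X) (iso_sym YXP) _ => u uh.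
    have [i [j [p [q [[ih jh ph qh] [iE jE pE qE]]]]]] := dsum_maps X1 P.
    have zp : zero_hom X X1 := zero_hom_transpose YX XX1 (TF0 _ _ TX0 FY0).
    have zq := zero_hom_projective (transpose_zero_hom YX) projP.
    apply/lfunP => x; rewrite zero_lfunE.
    have := congr1 (fun f : 'Hom(_, _) => f x) (zp _ (is_hom_comp ph uh)).
    have := congr1 (fun f : 'Hom(_, _) => f x) (zq _ (is_hom_comp qh uh)).
    by rewrite !comp_lfunE !zero_lfunE pE qE; case: (u x) => y z /= -> ->.
  (* The projective summand goes entirely to the torsion-free side. The rest is the transpose of
     some [C], and the canonical sequence of [C] is transposed; its torsion part has no forms
     because the algebra is torsion-free. *)
  move=> N; have [Z [P [zZ projP NZP]]] := torsionless_split N.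
  have [C CZ] := transpose_pre_ex zZ.
  have [U [V [i [q [TU FV ii qs /limg_lkerP iq]]]]] := seq C.
  have zU := TF0 _ _ TU (projF _ (@regular_projective s)).
  have [X1 [X2 [i' [q' [VX1 UX2 i'i q's iq']]]]] := transpose_exact ii qs iq zU CZ.
  have /isoP[e [e' [eh e'h eK e'K]]] := NZP.
  have [a [b [c [d [[ah bh ch dh] [aE bE cE dE]]]]]] := dsum_maps Z P.
  have [a2 [b2 [c2 [d2 [[a2h b2h c2h d2h] [a2E b2E c2E d2E]]]]]] := dsum_maps X2 P.
  pose r : 'Hom(direct_sum Z P, direct_sum X2 P) :=
    ((a2 \o (q' \o c)) + (b2 \o d))%VF.
  have rE z : r z = (q' z.1, z.2).
    rewrite add_lfunE !comp_lfunE a2E b2E cE dE.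
    by apply/eqP; rewrite -pair_eqE /= addr0 add0r !eqxx.
  have rh : is_hom r.
    by move=> t z; rewrite !add_lfunE !comp_lfunE ch dh q's.1 a2h b2h linearD.
  exists X1, (direct_sum X2 P), (e' \o (a \o i'))%VF, (r \o e)%VF; split.
  - by exists V.
  - by exists X2, P; split=> //; [exists U|apply: iso_refl].
  - apply: injective_hom_comp; first by split=> //; apply: can_inj e'K.
    by apply: injective_hom_comp => //; split=> // x y; rewrite !aE => -[].
  - apply/surjective_homP; split=> [|[x y]]; first exact: is_hom_comp.
    have [z zx] := (limg_fullP q').1 q's.2 x.
    by exists (e' (z, y)); rewrite comp_lfunE e'K rE zx.
  apply/limg_lkerP => y; rewrite comp_lfunE rE; split=> [[/iq'[x xE] y0]|[x ->]].
    exists x; rewrite !comp_lfunE aE -xE -[LHS]eK; congr (e' _).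
    by case: (e y) xE y0 => ? ? /= _ ->.
  by rewrite !comp_lfunE e'K aE /= (iq' (i' x)).2 //; exists x.
(* The torsion part of a projective is a transpose, so its inclusion is zero and the projective is
   torsion-free. *)
split=> // P projP; have [isoT' isoF' TF0' seq'] := tp.
have [X1 [X2 [i [q [TX1 FX2 ii qs /limg_lkerP iq]]]]] := seq' P.
apply: isoF' FX2; apply: iso_sym; exists q; split=> //; split; first by case: qs.
apply/lfun_injP => x /iq[y ->]; have [X0 _ X01] := TX1.
rewrite (zero_hom_projective (transpose_zero_hom X01) projP ii.1).
by rewrite zero_lfunE.
Qed.

Lemma flip_dsum s (Y Z P : kqmod s) : isomorphic Y (direct_sum Z P) ->
  isomorphic (flip Y) (direct_sum (flip Z) (flip P)).
Proof. by case: s Y Z P. Qed.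

Lemma flip_projective s (P : kqmod s) : is_projective P -> is_projective (flip P).
Proof. by case: s P. Qed.

Definition unflip_pair s (TF : subcat_pair (opp_side (opp_side s))) : subcat_pair s :=
  ((fun M => TF.1 (flip M)), (fun M => TF.2 (flip M))).

Lemma unflip_torsion s (TF : subcat_pair (opp_side (opp_side s))) :
  torsion_pair TF -> torsion_pair (unflip_pair TF).
Proof. by case: s TF => -[T F]. Qed.

(** By [torsion_pair_eq] two inclusions suffice. A torsion module has no forms and is its own double
    transpose; a torsion-free one is such a module plus a projective, both lying in the new
    class. *)
Lemma transpose_pairK s (TF : subcat_pair s) :
  torsion_pair TF -> (forall P, is_projective P -> TF.2 P) ->
  unflip_pair (transpose_pair (transpose_pair TF)) = TF.
Proof.
move=> tp projF; have [tp1 projF1] := transpose_pair_torsion tp projF.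
have [tp2 _] := transpose_pair_torsion tp1 projF1.
symmetry; apply: (torsion_pair_eq tp (unflip_torsion tp2)).
- move=> X TX; have [_ _ TF0 _] := tp.
  have [C [XC CX]] := transpose_inv_ex (TF0 _ _ TX (projF _ (@regular_projective s))).
  exists C => //; have [P projP P0] := zero_projective_ex (opp_side s).
  by exists C, P; split=> //; [exists X|apply: dsum0_iso].
move=> Y FY; have [Z [P [zZ projP YZP]]] := torsionless_split Y.
have [C [ZC CZ]] := transpose_inv_ex zZ.
exists (flip Z), (flip P); split; last exact: flip_dsum.
  exists C => //; exists Z => //.
  (* [Z] is torsion-free as a submodule of [Y]. *)
  have [i [j [p [q [[ih jh ph qh] [iE _ _ _]]]]]] := dsum_maps Z P.
  have /isoP[e [e' [eh e'h eK e'K]]] := YZP.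
  apply: (torsion_pair_sub (j := (e' \o i)%VF) tp _ FY).
  apply: injective_hom_comp; first by split=> //; apply: can_inj e'K.
  by split=> // x y; rewrite !iE => -[].
exact: flip_projective.
Qed.

Lemma dual_pairK s (TF : subcat_pair s) :
  torsion_pair TF -> unflip_pair (dual_pair (dual_pair TF)) = TF.
Proof.
move=> tp; have tp2 := dual_pair_torsion (dual_pair_torsion tp).
symmetry; apply: (torsion_pair_eq tp (unflip_torsion tp2)).
- move=> X TX; exists (dual X); last exact: bidual_iso.
  by exists X => //; apply: iso_refl.
- move=> X FX; exists (dual X); last exact: bidual_iso.
  by exists X => //; apply: iso_refl.
Qed.

End TorsionPairs.

(** * The maps sigma^- and sigma on left modules *)

Section Correspondence.
Variables (K : fieldType) (Q : acyclicQuiver).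
Local Notation kqmod := (kqmod K Q).
Local Notation subcat_pair s := ((kqmod s -> Prop) * (kqmod s -> Prop))%type.

Lemma class_eq (s : side) (D E : kqmod s -> Prop) :
  (forall M, D M <-> E M) -> D = E.
Proof.
move=> DE; apply: functional_extensionality => M.
exact: propositional_extensionality.
Qed.

Definition sigma_inv_pair (TF : subcat_pair Left) : subcat_pair Left :=
  (tau_inv_cat TF.1, dsum_cat (tau_inv_cat TF.2) Proj).

Definition sigma_pair (TF : subcat_pair Left) : subcat_pair Left :=
  (dsum_cat Inj (tau_cat TF.1), tau_cat TF.2).

Lemma tau_inv_catE (D : kqmod Left -> Prop) :
  tau_inv_cat D = transpose_class (dual_class D).
Proof.
apply: class_eq => N; split=> [[M DM /is_transposeP MN]|[M [X DX MX] MN]].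
  by exists (dual M) => //; exists M => //; apply: iso_refl.
by exists X => //; apply/is_transposeP; apply: has_transpose_iso MX (iso_refl _) MN.
Qed.

Lemma tau_catE (D : kqmod Left -> Prop) :
  tau_cat D = dual_class (transpose_class D).
Proof.
apply: class_eq => N; split=> [[M DM [C [/is_transposeP MC NC]]]|[C [M DM MC] NC]].
  by exists C => //; exists M.
by exists M => //; exists C; split=> //; apply/is_transposeP.
Qed.

Lemma sigma_inv_pairE TF : sigma_inv_pair TF = transpose_pair (dual_pair TF).
Proof. by rewrite /sigma_inv_pair !tau_inv_catE. Qed.

(** Beyond unfolding, the dual of a sum with a projective summand has to be matched with a sum with
    an injective summand, in the other order. *)
Lemma sigma_pairE TF : sigma_pair TF = dual_pair (transpose_pair TF).
Proof.
rewrite /sigma_pair !tau_catE; congr pair; apply: class_eq => N.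
split=> [[I [X [injI [C TC XC] NIX]]]|[X [C [P [TC projP XCP]] NX]]].
  exists (direct_sum C (dual I : kqmod Right)).
    by exists C, (dual I); split=> //; [apply: dual_projective|apply: iso_refl].
  apply: iso_trans NIX (iso_trans (dsumC_iso _ _) _).
  exact: (@iso_trans K Q Left _ _ _ (dsum_iso XC (bidual_iso I))
    (iso_sym (@dual_dsum K Q Right C (dual I)))).
exists (dual P), (dual C); split; first exact: dual_injective projP.
  by exists C => //; apply: iso_refl.
apply: iso_trans NX (iso_trans (dual_iso XCP) _).
exact: iso_trans (dual_dsum _ _) (dsumC_iso _ _).
Qed.

Definition in_F1 (TF : subcat_pair Left) := is_torsion_pair TF /\ subcat Inj TF.1.
Definition in_F2 (TF : subcat_pair Left) := is_torsion_pair TF /\ subcat Proj TF.2.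

Lemma in_F1_torsion TF : in_F1 TF -> torsion_pair TF.
Proof. by case=> -[isoT isoF TF0 seq] _; split=> // X Y TX FY f; apply: TF0. Qed.

Lemma in_F1_projective TF : in_F1 TF ->
  forall P, is_projective P -> (dual_pair TF).2 P.
Proof.
case=> _ injT P projP; have [N PN] := dual_ess P; exists N => //.
exact/injT/injective_of_dual/projective_iso/projP.
Qed.

Lemma in_F2_torsion TF : in_F2 TF -> torsion_pair TF.
Proof. by case=> -[isoT isoF TF0 seq] _; split=> // X Y TX FY f; apply: TF0. Qed.

Lemma torsion_is_torsion (TF : subcat_pair Left) :
  torsion_pair TF -> is_torsion_pair TF.
Proof. by case=> isoT isoF TF0 seq; split=> // X Y f TX FY; apply: TF0. Qed.

Lemma sigma_inv_in_F2 TF : in_F1 TF -> in_F2 (sigma_inv_pair TF).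
Proof.
move=> TF1; rewrite sigma_inv_pairE.
have [tp projF] := transpose_pair_torsion
  (dual_pair_torsion (in_F1_torsion TF1)) (in_F1_projective TF1).
split; [exact: torsion_is_torsion tp|exact: projF].
Qed.

Lemma sigma_in_F1 TF : in_F2 TF -> in_F1 (sigma_pair TF).
Proof.
move=> TF2; rewrite sigma_pairE.
have [tp projF] := transpose_pair_torsion (in_F2_torsion TF2) TF2.2.
split; first exact: torsion_is_torsion (dual_pair_torsion tp).
move=> I injI; have [N IN] := @dual_ess K Q Right I; exists N => //.
exact/projF/projective_of_dual/injective_iso/injI.
Qed.

Lemma sigma_invK TF : in_F1 TF -> sigma_pair (sigma_inv_pair TF) = TF.
Proof.
move=> TF1; have tp := in_F1_torsion TF1; rewrite sigma_pairE sigma_inv_pairE.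
(* At a concrete side [unflip_pair] reduces away, so the types and the equation agree by
   conversion. *)
have e : dual_pair (dual_pair TF) = TF := dual_pairK tp.
rewrite -[RHS]e; apply: (congr1 (@dual_pair K Q Right)).
exact: transpose_pairK (dual_pair_torsion tp) (in_F1_projective TF1).
Qed.

Lemma sigmaK TF : in_F2 TF -> sigma_inv_pair (sigma_pair TF) = TF.
Proof.
move=> TF2; have tp := in_F2_torsion TF2; rewrite sigma_pairE sigma_inv_pairE.
have [tp' _] := transpose_pair_torsion tp TF2.2.
have e : transpose_pair (transpose_pair TF) = TF := transpose_pairK tp TF2.2.
rewrite -[RHS]e; apply: (congr1 (@transpose_pair K Q Right)).
exact: dual_pairK tp'.
Qed.

End Correspondence.

Theorem proposition5p3 (K : closedFieldType) (Q : acyclicQuiver)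
    (no_proj_inj : forall M : kqmod K Q Left,
       is_projective M -> is_injective M -> forall x : M, x = 0%R) :
  exists (sigma_inv : F1 K Q -> F2 K Q) (sigma : F2 K Q -> F1 K Q),
    [/\ cancel sigma_inv sigma,
        cancel sigma sigma_inv,
        forall TF' : F1 K Q,
          let: (T', F') := sval TF' in
          sval (sigma_inv TF') =
            (tau_inv_cat T', dsum_cat (tau_inv_cat F') Proj)
      & forall TF'' : F2 K Q,
          let: (T'', F'') := sval TF'' in
          sval (sigma TF'') =
            (dsum_cat Inj (tau_cat T''), tau_cat F'')].
Proof.
exists (fun TF => exist _ _ (sigma_inv_in_F2 (svalP TF))).
exists (fun TF => exist _ _ (sigma_in_F1 (svalP TF))).
split.
(* Elements of [F1] carry a proof, so equality is reduced to the underlying pairs by proof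
   irrelevance. *)
- move=> [TF TF1]; apply: eq_sig_hprop => [x p q|].
    exact: proof_irrelevance.
  exact: sigma_invK.
- move=> [TF TF2]; apply: eq_sig_hprop => [x p q|].
    exact: proof_irrelevance.
  exact: sigmaK.
- by case=> -[].
- by case=> -[].
Qed.
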